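(* Let $G$ be a connected infinite graph with more than one end. The following are equivalent: (i) $G$ is distance-transitive; (ii) $G$ is $2$-distance-transitive; (iii) $G\cong X_{\kappa,\lambda}$ for some cardinals $\kappa,\lambda\geq 2$.
   Context: For $k\in\mathbb{N}$, a graph $G$ is $k$-distance-transitive if for every two pairs $(x_1,x_2)$, $(y_1,y_2)$ of vertices with $d(x_1,x_2)=d(y_1,y_2)\le k$ there is an automorphism $\alpha$ of $G$ with $x_i^\alpha=y_i$ for $i=1,2$. $G$ is distance-transitive if it is $k$-distance-transitive for all $k\in\mathbb{N}$. Two rays (one-way infinite paths) are equivalent if no finite vertex set $S$ separates them, i.e. there is no finite $S$ such that the two rays eventually lie in distinct components of $G-S$; the equivalence classes are the ends of $G$. For cardinals $\kappa,\lambda\ge 2$, $X_{\kappa,\lambda}$ denotes the (unique up to isomorphism) connected graph of connectivity $1$ in which every block is a complete graph on $\kappa$ vertices and every vertex lies in exactly $\lambda$ distinct blocks. *)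

(* Defs.v *)
From mathcomp Require Import all_boot.
From mathcomp Require Import boolp classical_sets functions cardinality.

Set Implicit Arguments.
Unset Strict Implicit.
Unset Printing Implicit Defensive.

Local Open Scope classical_set_scope.
Local Open Scope card_scope.

(* Simple graphs on an arbitrary, possibly uncountable, vertex type. A
   boolean adjacency is no restriction: boolp turns every relation into one. *)
Record graph := Graph {
  vertex :> Type;
  adj : rel vertex;
  adj_sym : symmetric adj;
  adj_irr : irreflexive adj }.

Definition isomorphism (G H : graph) (f : G -> H) : Prop :=
  bijective f /\ forall x y : G, adj (f x) (f y) = adj x y.

Definition isomorphic (G H : graph) : Prop :=
  exists f : G -> H, isomorphism f.

(* Not necessarily induced. *)
Record subgraph (G : graph) := Subgraph {
  vert : set G;
  edge : rel G;
  edge_sym : symmetric edge;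
  edge_adj : forall x y, edge x y -> adj x y;
  edge_vert : forall x y, edge x y -> vert x }.

Lemma del_edge_sym (G : graph) (H : subgraph G) (S : set G) :
  symmetric (fun x y => [&& edge H x y, x \notin S & y \notin S]).
Proof. by move=> x y; rewrite edge_sym [(y \notin S) && _]andbC. Qed.

Lemma del_edge_adj (G : graph) (H : subgraph G) (S : set G) (x y : G) :
  [&& edge H x y, x \notin S & y \notin S] -> adj x y.
Proof. by case/and3P => /edge_adj. Qed.

Lemma del_edge_vert (G : graph) (H : subgraph G) (S : set G) (x y : G) :
  [&& edge H x y, x \notin S & y \notin S] -> (vert H `\` S) x.
Proof.
by case/and3P => /edge_vert Hx xS _; split=> // /mem_set; apply/negP.
Qed.

Definition del (G : graph) (H : subgraph G) (S : set G) : subgraph G :=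
  Subgraph (@del_edge_sym G H S) (@del_edge_adj G H S) (@del_edge_vert G H S).

Definition whole (G : graph) : subgraph G :=
  @Subgraph G setT (@adj G) (@adj_sym G) (fun _ _ e => e) (fun _ _ _ => I).

Definition sub (G : graph) (H K : subgraph G) : Prop :=
  vert H `<=` vert K /\ forall x y, edge H x y -> edge K x y.

Definition maximal_subgraph (G : graph) (P : subgraph G -> Prop)
    (H : subgraph G) : Prop :=
  P H /\ forall K, P K -> sub H K -> K = H.

Definition linked (G : graph) (H : subgraph G) (x y : G) : Prop :=
  vert H x /\ exists p : seq G, path (edge H) x p /\ last x p = y.

Definition connected (G : graph) (H : subgraph G) : Prop :=
  vert H !=set0 /\ forall x y, vert H x -> vert H y -> linked H x y.

Definition component (G : graph) (H : subgraph G) : subgraph G -> Prop :=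
  maximal_subgraph (fun C => sub C H /\ connected C).

Definition cutvertex (G : graph) (H : subgraph G) (v : G) : Prop :=
  vert H v /\ exists x y : G,
    [/\ x <> v, y <> v, linked H x y & ~ linked (del H [set v]) x y].

Definition block (G : graph) : subgraph G -> Prop :=
  maximal_subgraph (fun B => connected B /\ forall v, ~ cutvertex B v).

Definition k_connected (k : nat) (G : graph) : Prop :=
  `I_(k.+1) #<= [set: G] /\
  forall (S : set G) (n : nat),
    n < k -> S #= `I_n -> connected (del (whole G) S).

Definition has_connectivity (G : graph) (k : nat) : Prop :=
  k_connected k G /\ forall m, k_connected m G -> m <= k.

(* A walk of length n from x to y and none shorter, i.e. d(x,y) = n; vertices
   in different components are at no natural distance. *)
Definition distance (G : graph) (x y : G) (n : nat) : Prop :=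
  (exists p : seq G, [/\ path (@adj G) x p, last x p = y & size p = n]) /\
  forall p : seq G, path (@adj G) x p -> last x p = y -> n <= size p.

Definition k_distance_transitive (k : nat) (G : graph) : Prop :=
  forall (x1 x2 y1 y2 : G) (n : nat),
    n <= k -> distance x1 x2 n -> distance y1 y2 n ->
    exists a : G -> G, [/\ isomorphism a, a x1 = y1 & a x2 = y2].

Definition distance_transitive (G : graph) : Prop :=
  forall k : nat, k_distance_transitive k G.

Definition ray (G : graph) (r : nat -> G) : Prop :=
  injective r /\ forall n, adj (r n) (r n.+1).

Definition separates (G : graph) (S : set G) (r s : nat -> G) : Prop :=
  exists C D : subgraph G,
    [/\ component (del (whole G) S) C, component (del (whole G) S) D, C <> D &
        exists N : nat, forall n, N <= n -> vert C (r n) /\ vert D (s n)].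

Definition equivalent_rays (G : graph) (r s : nat -> G) : Prop :=
  forall S : set G, finite_set S -> ~ separates S r s.

Definition ends (G : graph) : set (set (nat -> G)) :=
  [set e | exists2 r, ray r & e = [set s | ray s /\ equivalent_rays r s]].
Arguments ends : clear implicits.

(* The cardinals kappa and lambda are those of the types K and L. This is the
   property that determines X_{kappa,lambda} up to isomorphism. *)
Definition is_X (K L : Type) (X : graph) : Prop :=
  [/\ connected (whole X),
      has_connectivity X 1,
      forall B : subgraph X, block B ->
        vert B #= [set: K] /\
        forall x y, vert B x -> vert B y -> x <> y -> edge B x y &
      forall v : X, [set B : subgraph X | block B /\ vert B v] #= [set: L]].

(* Main.v *)
(* From 2-distance-transitivity to a cutvertex.  Let k be the least size of a
   finite set S such that two components of G - S contain rays.  Uncrossing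
   shows that the k-cuts crossed by the fewest other k-cuts are pairwise nested;
   this family is invariant under automorphisms.  By transitivity any two
   vertices at distance 2 lie in different ray components of some member of the
   family, so by nestedness no member contains two vertices at distance 2.  If
   k > 1, a shortest path through a ray component between two vertices of a
   member must then have length 2, so some edge, hence every edge, lies in a
   member.  Walking along edges cs into ever smaller components produces pairs
   at distance 2 separated by arbitrarily many members, whereas only finitely
   many separators of size k separate two given vertices.  So k = 1, and
   transitivity makes all blocks complete.

   Conversely, let all blocks be complete.  Walks in which consend_cutive triples
   are induced paths are unique, so an isomorphism between closed neighbourhoods
   extends along them, block by block, to an automorphism; prescribing one more
   vertex at a time yields transitivity on geodesics. *)
Require Import Defs.
From mathcomp Require Import all_boot.
From mathcomp Require Import finmap.
From mathcomp Require Import boolp classical_sets functions cardinality.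

Set Implicit Arguments.
Unset Strict Implicit.
Unset Printing Implicit Defensive.

Local Open Scope classical_set_scope.
Local Open Scope card_scope.

(** * Reachability inside a vertex set *)

(** A minimum cut crossing a cut [S] separates two vertices of [S], so only finitely many do;
    crossing numbers are therefore genuine counts, and replacing two crossing cuts by the boundaries
    of two opposite corners lowers the sum of these counts. Complete blocks come from the cutvertex
    v0: an automorphism taking two nonadjacent neighbours of v to two neighbours of v0 separated by
    v0 must take v to v0, so v separates them too. In the converse the cardinals are arbitrary, so
    there is no enumeration of vertices to work along. Instead the value of an automorphism at each
    vertex is read off from the reduced walk to a base vertex. The local choices are made once for
    all steps, and are the identity whenever the shared clique is fixed pointwise. Hence whatever
    lies beyond a fixed clique stays fixed, and a correction at one end of a geodesic does not
    disturb the part already placed. *)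

Section Reach.
Variable G : graph.
Implicit Types (A B S : set G) (x y z : G) (H K C : subgraph G).

Lemma adjC x y : adj x y = adj y x. Proof. exact: adj_sym. Qed.

Lemma adj_neq x y : adj x y -> x <> y.
Proof. by move=> xy e; move: xy; rewrite e adj_irr. Qed.

(** The cut arguments only delete vertices, so walks are confined by a vertex set rather than by a
    [subgraph]; [linked_induced] translates. *)
Inductive reach (A : set G) (x : G) : G -> Prop :=
| reach_refl : A x -> reach A x x
| reach_step y z : reach A x y -> adj y z -> A z -> reach A x z.

Lemma reach_src A x y : reach A x y -> A x.
Proof. by elim. Qed.

Lemma reach_tgt A x y : reach A x y -> A y.
Proof. by elim. Qed.

Lemma reach_sub A B x y : A `<=` B -> reach A x y -> reach B x y.
Proof.
move=> AB; elim=> [/AB|u v _ h uv /AB]; first exact: reach_refl.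
exact: reach_step h uv.
Qed.

Lemma reach_trans A y x z : reach A x y -> reach A y z -> reach A x z.
Proof. by move=> xy; elim=> // u v _ h uv; apply: reach_step h uv. Qed.

Lemma reach_edge A x y : A x -> A y -> adj x y -> reach A x y.
Proof. by move=> Ax Ay xy; apply: reach_step xy Ay; apply: reach_refl. Qed.

Lemma reach_sym A x y : reach A x y -> reach A y x.
Proof.
elim=> [|u v xu h uv Av]; first exact: reach_refl.
by apply: reach_trans h; apply: reach_edge (reach_tgt xu) _; rewrite // adjC.
Qed.

Lemma reach_closed A (P : set G) x y :
  (forall u v, P u -> adj u v -> A v -> P v) -> reach A x y -> P x -> P y.
Proof.
by move=> cl; elim=> // u v _ h uv Av Px; apply: (cl u) => //; apply: h.
Qed.

Lemma reach_in A (P : set G) x y :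
    (forall u v, P u -> adj u v -> A v -> P v) -> reach A x y -> P x ->
  reach P x y.
Proof.
move=> cl; elim=> [_ /reach_refl//|u v _ h uv Av /h Pu].
exact: reach_step Pu uv (cl _ _ (reach_tgt Pu) uv Av).
Qed.

Lemma linked_refl H x : vert H x -> linked H x x.
Proof. by move=> Hx; split=> //; exists [::]. Qed.

Lemma linked_step H x y z : linked H x y -> edge H y z -> linked H x z.
Proof.
move=> [Hx [p [xp <-]]] e; split=> //; exists (rcons p z).
by rewrite rcons_path xp e last_rcons.
Qed.

Lemma linked_ind H x (P : G -> Prop) :
    P x -> (forall y z, linked H x y -> P y -> edge H y z -> P z) ->
  forall y, linked H x y -> P y.
Proof.
move=> Px st y [Hx [p [xp <-]]].
elim/last_ind: p xp => //= p z IH; rewrite rcons_path last_rcons => /andP[xp e].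
by apply: (st (last x p)) e; [split=> //; exists p | exact: IH].
Qed.

Lemma linked_trans H y x z : linked H x y -> linked H y z -> linked H x z.
Proof.
move=> xy; move: z; apply: linked_ind => // u v _ xu uv.
exact: linked_step xu uv.
Qed.

Lemma linked_sym H x y : linked H x y -> linked H y x.
Proof.
move=> xy; have Hx := xy.1; move: y xy.
apply: linked_ind => [|y z _ yx yz]; first exact: linked_refl.
apply: linked_trans _ yx; apply: (@linked_step _ _ z); last by rewrite edge_sym.
by apply/linked_refl/(@edge_vert _ _ _ y); rewrite edge_sym.
Qed.

Lemma linked_vert H x y : linked H x y -> vert H y.
Proof. by move/linked_sym; case. Qed.

Lemma linked_sub H K x y : sub H K -> linked H x y -> linked K x y.
Proof.
move=> [sv se] xy; have Hx := sv _ xy.1; move: y xy.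
apply: linked_ind => [|y z _ yx yz]; first exact: linked_refl.
exact: linked_step yx (se _ _ yz).
Qed.

Lemma edge_vertr H x y : edge H x y -> vert H y.
Proof. by rewrite edge_sym; apply: edge_vert. Qed.

Lemma sub_anti H K : sub H K -> sub K H -> H = K.
Proof.
case: H K => [vH eH sH aH wH] [vK eK sK aK wK] [/= v1 e1] [/= v2 e2].
have ev : vH = vK by apply/seteqP.
have ee : eH = eK.
  by apply/funext => x; apply/funext => y; apply/idP/idP => [/e1|/e2].
move: sH aH wH sK aK wK {v1 e1 v2 e2}; rewrite ev ee => *.
by f_equal; apply: Prop_irrelevance.
Qed.

Lemma induced_sym A : symmetric (fun x y => [&& adj x y, x \in A & y \in A]).
Proof. by move=> x y; rewrite adjC [(x \in A) && _]andbC. Qed.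

Lemma induced_adj A x y : [&& adj x y, x \in A & y \in A] -> adj x y.
Proof. by case/andP. Qed.

Lemma induced_vert A x y : [&& adj x y, x \in A & y \in A] -> A x.
Proof. by case/and3P => _ /set_mem. Qed.

Definition induced A : subgraph G :=
  Subgraph (@induced_sym A) (@induced_adj A) (@induced_vert A).

Lemma inducedE A x y : edge (induced A) x y <-> [/\ adj x y, A x & A y].
Proof.
split; first by case/and3P => xy /set_mem Ax /set_mem Ay.
by case=> xy /mem_set Ax /mem_set Ay; apply/and3P.
Qed.

Lemma delE H S x y : edge (del H S) x y <-> [/\ edge H x y, ~ S x & ~ S y].
Proof.
split.
  by case/and3P => xy /negP xS /negP yS; split=> // [/mem_set|/mem_set].
case=> xy xS yS; apply/and3P; split=> //; apply/negP => /set_mem //.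
Qed.

Lemma linked_induced A x y : linked (induced A) x y <-> reach A x y.
Proof.
split.
  move=> xy; have Ax := xy.1; move: y xy.
  apply: linked_ind => [|y z _ xy]; first exact: reach_refl.
  by case/inducedE => yz _; apply: reach_step xy yz.
elim=> [Ax|u v xu h uv Av]; first exact: linked_refl.
by apply: linked_step h _; apply/inducedE; split=> //; apply: reach_tgt xu.
Qed.

Lemma sub_induced H A : sub H (induced A) <-> vert H `<=` A.
Proof.
split=> [[]//|HA]; split=> // x y e; apply/inducedE; split.
- exact: edge_adj e.
- exact: HA _ (edge_vert e).
- exact: HA _ (edge_vertr e).
Qed.

Lemma del_induced H S A : vert H `<=` A -> sub (del H S) (induced (A `\` S)).
Proof. by move=> HA; apply/sub_induced => x [/HA]. Qed.

Lemma del_inducedE A S : del (induced A) S = induced (A `\` S).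
Proof.
apply: sub_anti; first exact: del_induced.
split=> // x y /inducedE[xy [Ax Sx] [Ay Sy]].
by apply/delE; split=> //; apply/inducedE.
Qed.

Lemma wholeE : whole G = induced setT.
Proof.
apply: sub_anti; first by apply/sub_induced.
by split=> // x y /inducedE[].
Qed.

Lemma linked_del S x y : linked (del (whole G) S) x y <-> reach (~` S) x y.
Proof. by rewrite wholeE del_inducedE setTD linked_induced. Qed.

Lemma reach_connected A :
  connected (induced A) <->
  A !=set0 /\ forall x y, A x -> A y -> reach A x y.
Proof.
split=> -[A0 h]; split=> // x y Ax Ay; apply/linked_induced; exact: h.
Qed.

Definition component_of S x : set G := [set y | reach (~` S) x y].

Lemma component_of_notin S x : component_of S x `<=` ~` S.
Proof. by move=> y; apply: reach_tgt. Qed.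

Lemma component_of_closed S x y z : component_of S x y -> adj y z ->
  ~ S z -> component_of S x z.
Proof. exact: reach_step. Qed.

Lemma component_of_eq S x y : component_of S x y -> component_of S y = component_of S x.
Proof.
move=> xy; apply/seteqP; split=> z; first exact: reach_trans xy.
by apply: reach_trans; apply: reach_sym.
Qed.

Lemma reach_component_of S x y z : component_of S x y -> component_of S x z ->
  reach (component_of S x) y z.
Proof.
move=> xy xz; have yz : reach (~` S) y z by apply: reach_trans xz; apply: reach_sym.
by apply: reach_in yz xy => u v; apply: component_of_closed.
Qed.

(** Replaces maximality among connected subgraphs by a reachability class: that class induces a
    connected subgraph containing [C]. *)
Lemma componentE S C x :
  component (del (whole G) S) C -> vert C x -> C = induced (component_of S x).
Proof.
rewrite wholeE del_inducedE setTD => -[[/sub_induced CS [_ Cc]] Cmax] Cx.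
have CK : sub C (induced (component_of S x)).
  apply/sub_induced => y Cy; apply/linked_induced.
  by apply: linked_sub (Cc _ _ Cx Cy); apply/sub_induced.
apply/esym/Cmax => //; split; first by apply/sub_induced/component_of_notin.
apply/reach_connected; split; last exact: reach_component_of.
by exists x; apply: reach_refl; apply: CS.
Qed.

End Reach.

(** * Rays and finite separators *)

Section Size.
Variables (T U : Type).
Implicit Types A B : set T.

(** Arbitrary types carry no decidable equality, hence [{classic T}]. An infinite set gets the
    default size 0, so finiteness is stated separately. *)
Definition csize (A : set T) : nat :=
  size (enum_fset (fset_set (A : set {classic T}))).

Lemma csizeP A n : A #= `I_n <-> finite_set A /\ csize A = n.
Proof.
split=> [An|[[m Am] <-]].
  by split; [exists n | apply: (@card_fset_set {classic T} A)].
by rewrite /csize (@card_fset_set {classic T} A m).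
Qed.

Lemma csizeUI A B : finite_set A -> finite_set B ->
  csize (A `|` B) + csize (A `&` B) = csize A + csize B.
Proof.
move=> fA fB; rewrite /csize (@fset_setU {classic T}) // (@fset_setI {classic T}) //.
exact: cardfsUI.
Qed.

Lemma fset_set_subset A B : finite_set A -> finite_set B -> A `<=` B ->
  (fset_set (A : set {classic T}) `<=` fset_set (B : set {classic T}))%fset.
Proof. by move=> fA fB; rewrite (@fset_set_sub {classic T} A B fA fB). Qed.

Lemma csize_le A B : finite_set B -> A `<=` B -> csize A <= csize B.
Proof.
move=> fB AB; have fA := sub_finite_set AB fB.
exact/fsubset_leq_card/fset_set_subset.
Qed.

Lemma csize_lt A B x : finite_set B -> A `<=` B -> B x -> ~ A x ->
  csize A < csize B.
Proof.
move=> fB AB Bx nAx; have fA := sub_finite_set AB fB.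
apply: fproper_ltn_card; rewrite fproperEneq fset_set_subset // andbT.
apply/eqP => /(@fset_set_inj {classic T} _ _ fA fB) e.
by apply: nAx; rewrite e.
Qed.

Lemma csize0 : csize set0 = 0.
Proof. by rewrite /csize (@fset_set0 {classic T}). Qed.

Lemma csize_eq0 A : finite_set A -> csize A = 0 -> A = set0.
Proof.
move=> fA A0; apply/seteqP; split=> // x Ax.
by have := @csize_lt set0 A x fA (@sub0set _ _) Ax id; rewrite A0.
Qed.

Lemma csizeD1 A x : finite_set A -> A x -> csize A = (csize (A `\ x)).+1.
Proof.
move=> fA Ax; have := csizeUI (finite_set1 x) (finite_setD [set x] fA).
rewrite setDUK; last by move=> y ->.
have -> : [set x] `&` (A `\ x) = set0 by apply/seteqP; split=> // y [-> [_ /(_ erefl)]].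
have [] := (csizeP [set x] 1).1 card_set1 => _ ->.
by rewrite csize0 addn0.
Qed.
End Size.

Lemma csize_eq T U (A : set T) (B : set U) :
  finite_set A -> A #= B -> csize B = csize A.
Proof.
move=> [n An] AB; have [_ ->] := (csizeP A n).1 An.
by apply: (((csizeP B n).1) _).2; apply: card_eq_trans An; rewrite card_eq_sym.
Qed.

Section Rays.
Variable G : graph.
Implicit Types (A B S : set G) (x y z : G) (r s : nat -> G).

Definition has_ray A := exists r, ray r /\ forall n, A (r n).

Lemma has_ray_sub A B : A `<=` B -> has_ray A -> has_ray B.
Proof. by move=> AB [r [rr Ar]]; exists r; split=> // n; apply: AB. Qed.

Lemma ray_tail r N : ray r -> ray (fun n => r (N + n)).
Proof.
by case=> ri ra; split=> [i j /ri/addnI//|n]; rewrite addnS; apply: ra.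
Qed.

Lemma has_ray_tail A r N :
  ray r -> (forall n, N <= n -> A (r n)) -> has_ray A.
Proof.
move=> rr Ar; exists (fun n => r (N + n)); split; first exact: ray_tail.
by move=> n; apply: Ar; apply: leq_addr.
Qed.

Lemma ray_avoid S r : ray r -> finite_set S ->
  exists N, forall n, N <= n -> ~ S (r n).
Proof.
move=> [ri _] fS; have /finite_seqP[s rs] : finite_set (r @^-1` S).
  by apply: finite_preimage => // i j _ _; apply: ri.
exists (\max_(i <- s) i).+1 => n Nn Sn.
have ns : n \in s by have : (r @^-1` S) n by []; rewrite rs.
by move: Nn; rewrite (big_rem n ns) /= leqNgt ltnS leq_maxl.
Qed.

Lemma has_ray_avoid A S : finite_set S -> has_ray A -> has_ray (A `\` S).
Proof.
move=> fS [r [rr Ar]]; have [N rN] := ray_avoid rr fS.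
by apply: (has_ray_tail (N := N) rr) => n /rN.
Qed.

Lemma ray_reach A r m : ray r -> (forall n, m <= n -> A (r n)) ->
  forall n, m <= n -> reach A (r m) (r n).
Proof.
move=> rr Ar n /subnKC <-; elim: (n - m) => [|i IH].
  by rewrite addn0; apply: reach_refl; apply: Ar.
by rewrite addnS; apply: (reach_step IH (rr.2 _)); apply: Ar; rewrite -addnS leq_addr.
Qed.

Lemma has_ray_comp A S : has_ray A -> (forall x, A x -> ~ S x) ->
  exists x, A x /\ has_ray (component_of S x).
Proof.
move=> [r [rr Ar]] AS; exists (r 0); split => //; exists r; split=> // n.
by apply: (ray_reach rr) => // i _; apply: AS.
Qed.

(** A tail of the ray avoids [S]. It cannot leave [B] once inside, so it ends up inside [B] for good
    or outside [B] for good. *)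
Lemma has_ray_split A B S : finite_set S ->
    (forall x y, B x -> adj x y -> B y \/ S y) -> has_ray A ->
  has_ray (A `&` B) \/ has_ray (A `&` ~` (B `|` S)).
Proof.
move=> fS cl /(has_ray_avoid fS)[r [rr Ar]].
have [/choice[g hg]|] := pselect (forall m, exists n, m <= n /\ B (r n)); last first.
  move=> /existsNP[m /forallNP nB]; right; apply: (has_ray_tail (N := m) rr) => n mn.
  by split; [exact: (Ar n).1 | case=> [Bn|/(Ar n).2//]; apply: (nB n)].
left; apply: (has_ray_tail (N := g 0) rr) => n /subnKC <-.
split; first exact: (Ar _).1.
elim: (n - _) => [|i IH]; first by rewrite addn0; apply: (hg 0).2.
by rewrite addnS; case: (cl _ _ IH (rr.2 _)) => // /(Ar _.+1).2.
Qed.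

(** [A] is a union of components of G - S, not a single one, so that corners of two separations can
    be separations again. *)
Definition separation S A :=
  [/\ forall x, A x -> ~ S x,
      forall x y, A x -> adj x y -> A y \/ S y,
      has_ray A & has_ray (~` (A `|` S))].

Definition end_cut S := exists A, separation S A.

(** If no finite set separated any two rays, every class would consist of all rays. The rays
    obtained need not represent the given ends. *)
Lemma ends_separated (e f : set (nat -> G)) : ends G e -> ends G f -> e <> f ->
  exists r s S, [/\ ray r, ray s, finite_set S & separates S r s].
Proof.
move=> [r rr ->] [s rs ->] ne.
have [//|no] := pselect (exists r s S, [/\ ray r, ray s, finite_set S & separates S r s]).
case: ne; apply/seteqP; split=> t [rt _]; split=> // S fS sep; apply: no.
  by exists s, t, S.
by exists r, t, S.
Qed.

Lemma separates_end_cut S r s : ray r -> ray s -> separates S r s -> end_cut S.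
Proof.
move=> rr rs [C [D [hC hD CD [N h]]]].
have [/(componentE hC) eC /(componentE hD) eD] := h N (leqnn N).
have vC : vert C = component_of S (r N) by rewrite eC.
have vD : vert D = component_of S (s N) by rewrite eD.
exists (vert C); rewrite vC; split.
- exact: component_of_notin.
- move=> x y Cx xy; have [Sy|Sy] := pselect (S y); [by right|left].
  exact: component_of_closed Cx xy Sy.
- by apply: (has_ray_tail (N := N) rr) => n /h[]; rewrite vC.
- apply: (has_ray_tail (N := N) rs) => n /h[_]; rewrite vD => Dn.
  case=> [Cn|]; last exact: component_of_notin Dn.
  by apply: CD; rewrite eC eD -(component_of_eq Cn) -(component_of_eq Dn).
Qed.

End Rays.

(** * Uncrossing minimal cuts *)

Section Separators.
Variable G : graph.
Implicit Types (A S : set G) (x y : G).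

(** The ambient set [A] shrinks in the induction of [finite_min_separators]. Reachability is
    monotone, so minimality need only be tested by restoring single vertices. *)
Definition min_separator A x y S :=
  [/\ S `<=` A, finite_set S, ~ reach (A `\` S) x y &
      forall v, S v -> reach (A `\` (S `\ v)) x y].

Lemma reach_finite A x y : reach A x y ->
  exists2 P : set G, finite_set P & P `<=` A /\ reach P x y.
Proof.
elim=> [Ax|u v xu [P fP [PA xPu]] uv Av].
  exists [set x]; first exact: finite_set1.
  by split=> [_ ->//|]; apply: reach_refl.
exists (P `|` [set v]); first by rewrite finite_setU; split => //; exact: finite_set1.
split; first by move=> z [/PA|->].
apply: (reach_step (y := u)) => //; last by right.
by apply: reach_sub xPu; apply: subsetUl.
Qed.

(* Halin: every separator of size n+1 meets a fixed finite x-y path, and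
   removing a vertex v of that path leaves a minimal separator of G - v. *)
Lemma finite_min_separators n A x y :
  finite_set [set S | min_separator A x y S /\ csize S = n].
Proof.
elim: n A => [|n IH] A.
  apply: sub_finite_set (finite_set1 (set0 : set G)) => S [[_ fS _ _] S0].
  exact: csize_eq0.
have [xy|nxy] := pselect (reach A x y); last first.
  suff -> : [set S | min_separator A x y S /\ csize S = n.+1] = set0.
    exact: finite_set0.
  apply/seteqP; split=> // S [[SA fS nr ms] Sn].
  have [v Sv] : S !=set0.
    by apply/set0P/eqP => S0; move: Sn; rewrite S0 csize0.
  by apply: nxy; apply: reach_sub (ms v Sv) => z [].
have [P fP [PA xPy]] := reach_finite xy.
pose F v := (fun S => S `|` [set v]) @`
  [set S | min_separator (A `\ v) x y S /\ csize S = n].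
apply: (@sub_finite_set _ _ (\bigcup_(v in P) F v)); last first.
  by apply: bigcup_finite => // v _; apply: finite_image; apply: IH.
move=> S [[SA fS nr ms] Sn].
have [[v [Pv Sv]]|no] := pselect (exists v, P v /\ S v); last first.
  case: nr; apply: reach_sub xPy => z Pz; split; first exact: PA.
  by move=> Sz; apply: no; exists z.
exists v => //; exists (S `\ v); last by rewrite setDKU // => _ ->.
have eA : (A `\ v) `\` (S `\ v) = A `\` S.
  apply/seteqP; split=> z [].
    by move=> [Az zv] Sz; split=> // Sz'; apply: Sz.
  by move=> Az Sz; split; [split=> // zv; apply: Sz; rewrite zv | case].
split; last by move: Sn; rewrite (csizeD1 fS Sv) => -[].
split; [by move=> z [/SA] | exact: finite_setD | by rewrite eA |].
move=> u [Su uv]; apply: reach_sub (ms u Su) => z [Az nz]; split.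
  by split=> // zv; apply: nz; rewrite zv; split=> // vu; apply: uv.
by move=> [[Sz zv] zu]; apply: nz.
Qed.

End Separators.

Section Cuts.
Variable G : graph.
Implicit Types (A B S E C D : set G) (x y z : G).

Definition big_component S C :=
  (exists x, ~ S x /\ C = component_of S x) /\ has_ray C.

Lemma big_component_notin S C x : big_component S C -> C x -> ~ S x.
Proof. by move=> [[z [_ ->]] _]; apply: component_of_notin. Qed.

Lemma big_component_closed S C x y :
  big_component S C -> C x -> adj x y -> C y \/ S y.
Proof.
move=> [[z [_ ->]] _] Cx xy; have [Sy|Sy] := pselect (S y); [by right|left].
exact: component_of_closed Cx xy Sy.
Qed.

Lemma big_component_reach S C x y : big_component S C -> C x -> C y -> reach C x y.
Proof. by move=> [[z [_ ->]] _]; apply: reach_component_of. Qed.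

Lemma big_component_of S C x : big_component S C -> C x -> C = component_of S x.
Proof. by move=> [[z [_ ->]] _] zx; rewrite (component_of_eq zx). Qed.

Lemma big_component_eq S C D x :
  big_component S C -> big_component S D -> C x -> D x -> C = D.
Proof.
by move=> hC hD Cx Dx; rewrite (big_component_of hC Cx) (big_component_of hD Dx).
Qed.

Lemma big_component_ne S C : big_component S C -> exists x, C x.
Proof. by move=> [_ [r [_ Cr]]]; exists (r 0). Qed.

Lemma big_component_in S A : has_ray A -> (forall x, A x -> ~ S x) ->
    (forall x y, A x -> adj x y -> A y \/ S y) ->
  exists2 C, big_component S C & C `<=` A.
Proof.
move=> rA AS cl; have [x [Ax rx]] := has_ray_comp rA AS.
exists (component_of S x); first by split=> //; exists x; split=> //; apply: AS.
move=> y xy; apply: (reach_closed _ xy) => // u v Au uv Sv.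
by case: (cl _ _ Au uv).
Qed.

Lemma big_component_sup S E D : big_component E D -> (forall x, D x -> ~ S x) ->
  exists2 C, big_component S C & D `<=` C.
Proof.
move=> hD DS; have [x Dx] := big_component_ne hD.
have sub : D `<=` component_of S x.
  by move=> y Dy; apply: reach_sub (big_component_reach hD Dx Dy); apply: DS.
exists (component_of S x) => //; split; last exact: has_ray_sub sub hD.2.
by exists x; split=> //; apply: DS.
Qed.

Lemma separationC S A : separation S A -> separation S (~` (A `|` S)).
Proof.
case=> AS cl rA rB; split=> //; first by move=> x nx Sx; apply: nx; right.
- move=> x y nx xy; have [Sy|Sy] := pselect (S y); [by right|left => -[Ay|//]].
  by apply: nx; apply: cl Ay _; rewrite adjC.
- apply: has_ray_sub rA => x Ax [nx|Sx]; first by apply: nx; left.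
  exact: AS Ax Sx.
Qed.

Lemma separation_big S A : separation S A -> exists2 C, big_component S C & C `<=` A.
Proof. by case=> AS cl rA _; apply: big_component_in. Qed.

Lemma end_cut_big S : end_cut S ->
  exists C D, [/\ big_component S C, big_component S D & C <> D].
Proof.
move=> [A hA]; have [C hC CA] := separation_big hA.
have [D hD DA] := separation_big (separationC hA); exists C, D; split=> // CD.
have [x Cx] := big_component_ne hC.
by apply: (DA x); [rewrite -CD | left; apply: CA].
Qed.

Lemma end_cut_other S C : end_cut S -> big_component S C ->
  exists2 D, big_component S D & D <> C.
Proof.
move=> /end_cut_big[D [D' [hD hD' DD']]] hC.
have [e|] := pselect (D = C); last by exists D.
by exists D' => // e'; apply: DD'; rewrite e e'.
Qed.

Lemma big_component_disj S C D x :
  big_component S C -> big_component S D -> C <> D -> C x -> ~ D x.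
Proof. by move=> hC hD CD Cx Dx; apply: CD; apply: (big_component_eq hC hD Cx Dx). Qed.

Lemma separation_big_component S C :
  end_cut S -> big_component S C -> separation S C.
Proof.
move=> eS hC; have [D hD DC] := end_cut_other eS hC.
split; [by move=> x; apply: big_component_notin hC
       |by move=> x y; apply: big_component_closed | exact: hC.2 |].
apply: has_ray_sub hD.2 => x Dx [Cx|]; last exact: big_component_notin hD Dx.
exact: big_component_disj hD hC DC Dx Cx.
Qed.

(* Symmetric in S and E for cuts of minimum size, despite its form. *)
Definition noncrossing S E :=
  exists2 D, big_component E D & forall x, D x -> ~ S x.

Section MinimalCuts.
Variable k : nat.
Hypothesis k_min : forall S, finite_set S -> end_cut S -> k <= csize S.

Definition min_cut S := [/\ finite_set S, csize S = k & end_cut S].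

(** Otherwise [S] without [s] would still separate [C] from a ray outside, against the choice of
    [k]. *)
Lemma min_cut_full S C s : min_cut S -> big_component S C -> S s ->
  exists2 c, C c & adj s c.
Proof.
move=> [fS Sk eS] hC Ss; have [//|no] := pselect (exists2 c, C c & adj s c).
have [CS cl rC rD] := separation_big_component eS hC.
suff /k_min : end_cut (S `\ s).
  by move=> /(_ (finite_setD _ fS)); rewrite -Sk (csizeD1 fS Ss) ltnn.
exists C; split=> //; first by move=> x /CS h [].
  move=> x y Cx xy; case: (cl x y Cx xy) => [|Sy]; [by left | right; split=> // ys].
  by apply: no; exists x => //; rewrite -ys adjC.
by apply: has_ray_sub rD => x nx [Cx|[Sx _]]; apply: nx; [left | right].
Qed.

(** A ray component of G - E avoiding [S] lies in one component [C] of G - S, and every vertex of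
    [E] has a neighbour in it. *)
Lemma noncrossing_side S E : min_cut S -> min_cut E -> noncrossing S E ->
  exists2 C, big_component S C & E `<=` C `|` S.
Proof.
move=> kS kE [D hD DS]; have [C hC DC] := big_component_sup hD DS.
exists C => // e Ee; have [d Dd ed] := min_cut_full kE hD Ee.
by apply: (big_component_closed hC (DC _ Dd)); rewrite adjC.
Qed.

(** Since [E] lies in [C] and [S], any second ray component of G - S avoids [E]. *)
Lemma noncrossing_sym S E : min_cut S -> min_cut E -> noncrossing S E -> noncrossing E S.
Proof.
move=> kS kE /noncrossing_side[]// C hC EC.
have [D hD DC] : exists2 D, big_component S D & D <> C by case: kS => _ _ /end_cut_other; apply.
exists D => // x Dx /EC[Cx|]; last exact: big_component_notin hD Dx.
exact: big_component_disj hD hC DC Dx Cx.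
Qed.

(** Each vertex of [E] has neighbours in both [C] and [D], so restoring it reconnects [s] and [t].
    This makes [finite_min_separators] applicable to minimum cuts. *)
Lemma min_cut_min_separator E C D s t : min_cut E -> big_component E C ->
  big_component E D -> C <> D -> C s -> D t -> min_separator setT s t E.
Proof.
move=> kE hC hD CD Cs Dt; have [fE _ _] := kE; split=> //.
  rewrite setTD => st; apply: (big_component_disj hC hD CD) Dt.
  by rewrite (big_component_of hC Cs).
move=> v Ev; have [c Cc vc] := min_cut_full kE hC Ev; have [d Dd vd] := min_cut_full kE hD Ev.
have CE : C `<=` setT `\` (E `\ v).
  by move=> x Cx; split=> // -[Ex _]; apply: big_component_notin hC Cx Ex.
have DE : D `<=` setT `\` (E `\ v).
  by move=> x Dx; split=> // -[Ex _]; apply: big_component_notin hD Dx Ex.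
apply: (@reach_trans _ _ d); last exact: reach_sub DE (big_component_reach hD Dd Dt).
apply: (@reach_step _ _ _ v) => //; last exact: DE Dd.
apply: (@reach_step _ _ _ c); [|by rewrite adjC|by split=> // -[_ /(_ erefl)]].
exact: reach_sub CE (big_component_reach hC Cs Cc).
Qed.

(** If [E] crosses [S], every ray component of G - E meets [S]; so [E] is a minimal separator of one
    of the finitely many pairs from [S]. *)
Lemma crossing_finite S : min_cut S -> finite_set [set E | min_cut E /\ ~ noncrossing S E].
Proof.
move=> [fS _ _].
apply: (@sub_finite_set _ _ (\bigcup_(p in S `*` S)
   [set E | min_separator setT p.1 p.2 E /\ csize E = k])); last first.
  apply: bigcup_finite; first exact: finite_setX.
  by move=> p _; apply: finite_min_separators.
move=> E [kE nc]; have [fE Ek eE] := kE.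
have [C [D [hC hD CD]]] := end_cut_big eE.
have meet B : big_component E B -> exists2 s, B s & S s.
  move=> hB; have [//|no] := pselect (exists2 s, B s & S s).
  by case: nc; exists B => // x Bx Sx; apply: no; exists x.
have [s Cs Ss] := meet C hC; have [t Dt St] := meet D hD.
exists (s, t) => //; split=> //=.
exact: min_cut_min_separator kE hC hD CD Cs Dt.
Qed.

Definition crossing_number S := csize [set E | min_cut E /\ ~ noncrossing S E].

Definition opposite S A := ~` (A `|` S).

Lemma big_component_side S A C : separation S A -> big_component S C ->
  C `<=` A \/ C `<=` opposite S A.
Proof.
move=> hA hC; have [x Cx] := big_component_ne hC.
have [Ax|nAx] := pselect (A x); [left|right] => y Cy.
  apply: (reach_closed _ (big_component_reach hC Cx Cy)) Ax => u v Au uv Cv.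
  by case: hA => _ cl _ _; case: (cl u v Au uv) => // /(big_component_notin hC Cv).
have [_ cl _ _] := separationC hA.
apply: (reach_closed _ (big_component_reach hC Cx Cy)) => [u v Au uv Cv|].
  by case: (cl u v Au uv) => // /(big_component_notin hC Cv).
by case=> // /(big_component_notin hC Cx).
Qed.

(** [E] lies in [S] and a single ray component of G - S, which is on one side of the separation; the
    other side avoids [E]. *)
Lemma noncrossing_separation S A E : min_cut S -> min_cut E -> noncrossing S E -> separation S A ->
  (forall x, A x -> ~ E x) \/ (forall x, opposite S A x -> ~ E x).
Proof.
move=> kS kE ncSE hA; have [C hC EC] := noncrossing_side kS kE ncSE.
have [AS _ _ _] := hA; have [CA|CA] := big_component_side hA hC; [right|left].
  by move=> x nx /EC[/CA Ax|Sx]; apply: nx; [left|right].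
by move=> x Ax /EC[/CA nx|/(AS x Ax)//]; apply: nx; left.
Qed.

Lemma noncrossing_avoid S S' E D : big_component E D ->
  (forall x, D x -> ~ S x) -> S' `<=` S -> noncrossing S' E.
Proof. by move=> hD DS S'S; exists D => // x /DS nS /S'S. Qed.

(** A ray component [C] of G - S avoiding [E] meets [S'], as [S] and [S'] cross. Hence [C], and with
    it [S], lies on the same side [F] of [E] as [S'], up to vertices of [E]; any other ray component
    of G - E avoids both. *)
Lemma noncrossing_both S S' E : min_cut S -> min_cut S' -> min_cut E ->
    ~ noncrossing S S' -> noncrossing S E -> noncrossing S' E ->
  exists2 D, big_component E D & forall x, D x -> ~ (S `|` S') x.
Proof.
move=> kS kS' kE cr nS nS'.
have [C hC CE] := noncrossing_sym kS kE nS.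
have [F hF S'F] := noncrossing_side kE kS' (noncrossing_sym kS' kE nS').
have [z [Cz S'z]] : exists z, C z /\ S' z.
  have [//|no] := pselect (exists z, C z /\ S' z).
  case: cr; apply: (noncrossing_sym kS' kS); exists C => // x Cx S'x.
  by apply: no; exists x.
have Fz : F z by case: (S'F z S'z) => // /(CE z Cz).
have [F' hF' CF'] := big_component_sup hC CE.
have CF : C `<=` F by rewrite (big_component_eq hF hF' Fz (CF' z Cz)).
have SF : S `<=` F `|` E.
  move=> s Ss; have [c Cc sc] := min_cut_full kS hC Ss.
  by apply: (big_component_closed hF (CF _ Cc)); rewrite adjC.
have [_ _ eE] := kE; have [D hD DF] := end_cut_other eE hF.
have DFE x : D x -> ~ (F `|` E) x.
  move=> Dx [Fx|]; first exact: big_component_disj hD hF DF Dx Fx.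
  exact: big_component_notin hD Dx.
by exists D => // x /DFE nx [/SF|/S'F].
Qed.

(** The part of the two cuts that can bound the intersection of the sides [A] and [B]. *)
Definition corner S A S' B := (S `&` B) `|` (S' `&` A) `|` (S `&` S').

Lemma corner_sub S A S' B : corner S A S' B `<=` S `|` S'.
Proof. by move=> x [[[]|[]]|[]]; [left|right|left]. Qed.

Lemma corner_separation S A S' B : separation S A -> separation S' B ->
    has_ray (A `&` B) -> has_ray (opposite S A `&` opposite S' B) ->
  separation (corner S A S' B) (A `&` B).
Proof.
move=> [AS clA _ _] [BS' clB _ _] rAB rAB'; split=> //.
- by move=> x [/AS nS /BS' nS'] /corner_sub[].
- move=> x y [Ax Bx] xy.
  case: (clA x y Ax xy) (clB x y Bx xy) => [Ay|Sy] [By|S'y]; first by left.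
  + by right; left; right.
  + by right; left; left.
  + by right; right.
- apply: has_ray_sub rAB' => x [nA nB] [[Ax _]|/corner_sub[Sx|S'x]].
  + by apply: nA; left.
  + by apply: nA; right.
  + by apply: nB; right.
Qed.

(** With [corner_meet] this gives the modular count: the boundaries of two opposite corners have the
    same total size as [S] and [S']. *)
Lemma corner_cover S A S' B : separation S A -> separation S' B ->
  corner S A S' B `|` corner S (opposite S A) S' (opposite S' B) = S `|` S'.
Proof.
move=> [AS _ _ _] [BS' _ _ _]; apply/seteqP; split.
  by move=> x [] /corner_sub.
move=> x [Sx|S'x].
  have [S'x|S'x] := pselect (S' x); first by left; right.
  have [Bx|Bx] := pselect (B x); first by left; left; left.
  by right; left; left; split=> // -[].
have [Sx|Sx] := pselect (S x); first by left; right.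
have [Ax|Ax] := pselect (A x); first by left; left; right.
by right; left; right; split=> // -[].
Qed.

Lemma corner_meet S A S' B : separation S A -> separation S' B ->
  corner S A S' B `&` corner S (opposite S A) S' (opposite S' B) = S `&` S'.
Proof.
move=> [AS _ _ _] [BS' _ _ _]; apply/seteqP; split; last by move=> x Sx; split; right.
move=> x [] [[[Sx Bx]|[S'x Ax]]|//] [[[Sx' Bx']|[S'x' Ax']]|//].
- by case: Bx'; left.
- by case: Ax'; right.
- by case: Bx'; right.
- by case: Ax'; left.
Qed.

(** The boundaries of two opposite corners have total size 2k and each is an end cut, hence each has
    size exactly [k]. *)
Lemma uncross_corners S S' A B : min_cut S -> min_cut S' -> ~ noncrossing S S' ->
    separation S A -> separation S' B ->
    has_ray (A `&` B) -> has_ray (opposite S A `&` opposite S' B) ->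
  exists S1 S2, [/\ min_cut S1, min_cut S2 &
    crossing_number S1 + crossing_number S2 < crossing_number S + crossing_number S'].
Proof.
move=> kS kS' cr hA hB rAB rAB'.
pose S1 := corner S A S' B; pose S2 := corner S (opposite S A) S' (opposite S' B).
have h1 : separation S1 (A `&` B) by apply: corner_separation.
have h2 : separation S2 (opposite S A `&` opposite S' B).
  apply: corner_separation => //; [exact: separationC | exact: separationC |].
  have [AS _ _ _] := hA; have [BS' _ _ _] := hB.
  by apply: has_ray_sub rAB => x [Ax Bx]; split=> -[[]|]; [left|exact: AS|left|exact: BS'].
have [fS Sk _] := kS; have [fS' S'k _] := kS'.
have fU : finite_set (S `|` S') by rewrite finite_setU.
have f1 : finite_set S1 by apply: sub_finite_set fU; apply: corner_sub.
have f2 : finite_set S2 by apply: sub_finite_set fU; apply: corner_sub.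
have c1 : k <= csize S1 by apply: k_min => //; exists (A `&` B).
have c2 : k <= csize S2.
  by apply: k_min => //; exists (opposite S A `&` opposite S' B).
have c12 : csize S1 + csize S2 = k + k.
  rewrite -csizeUI // corner_cover // corner_meet // csizeUI //.
  by rewrite Sk S'k.
have e1 : csize S1 = k.
  by apply/eqP; rewrite eqn_leq c1 -(leq_add2r (csize S2)) c12 leq_add2l c2.
have e2 : csize S2 = k by apply/eqP; rewrite -(eqn_add2l k) -c12 e1.
have k1 : min_cut S1 by split=> //; exists (A `&` B).
have k2 : min_cut S2 by split=> //; exists (opposite S A `&` opposite S' B).
exists S1, S2; split=> //.
have fin T : min_cut T -> finite_set [set E | min_cut E /\ ~ noncrossing T E].
  exact: crossing_finite _.
(* Each sum counts the cuts crossing at least one member of the pair plus those crossing both. The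
   first count drops strictly, the second does not grow. *)
rewrite /crossing_number -(csizeUI (fin _ k1) (fin _ k2))
  -(csizeUI (fin _ kS) (fin _ kS')).
have noE E T : min_cut E -> min_cut T -> ~ noncrossing T E -> ~ noncrossing E T.
  by move=> kE kT nc /(noncrossing_sym kE kT).
have off1 E : (forall x, (A `&` B) x -> ~ E x) -> noncrossing E S1.
  move=> no; have [D hD DA] := separation_big h1.
  by exists D => // x /DA; apply: no.
have off2 E : (forall x, (opposite S A `&` opposite S' B) x -> ~ E x) -> noncrossing E S2.
  move=> no; have [D hD DA] := separation_big h2.
  by exists D => // x /DA; apply: no.
have [AS _ _ _] := hA.
rewrite -addSn; apply: leq_add.
- apply: (@csize_lt _ _ _ S).
  + by rewrite finite_setU; split; apply: fin.
  + have both E : min_cut E -> noncrossing S E -> noncrossing S' E ->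
        noncrossing S1 E /\ noncrossing S2 E.
      move=> kE nS nS'; have [D hD DU] := noncrossing_both kS kS' kE cr nS nS'.
      by split; apply: noncrossing_avoid hD DU _; apply: corner_sub.
    move=> E [] [kE nc]; apply: contrapT => /not_orP[] /not_andP[//|/contrapT nS].
      by move=> /not_andP[//|/contrapT nS']; case: nc; case: (both E kE nS nS').
    by move=> /not_andP[//|/contrapT nS']; case: nc; case: (both E kE nS nS').
  (* Strictness: [S] crosses [S'], but it misses both corners and so crosses neither [S1] nor
     [S2]. *)
  + by right; split=> //; apply: noE.
  + case=> -[_]; apply; apply: (noncrossing_sym) => //.
      by apply: off1 => x [/AS].
    by apply: off2 => x [nx _] Sx; apply: nx; right.
- apply: csize_le; first exact/finite_setIl/fin.
  move=> E [[kE /(noE _ _ kE k1) n1] [_ /(noE _ _ kE k2) n2]]; split; split=> // nS.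
    case: (noncrossing_separation kS kE nS hA) => h.
      by apply/n1/off1 => x [/h].
    by apply/n2/off2 => x [/h].
  case: (noncrossing_separation kS' kE nS hB) => h.
    by apply/n1/off1 => x [_ /h].
  by apply/n2/off2 => x [_ /h].
Qed.

(** A ray on any side of one cut has a tail on one side of the other, so some two opposite corners
    both contain rays. *)
Lemma uncross S S' : min_cut S -> min_cut S' -> ~ noncrossing S S' ->
  exists S1 S2, [/\ min_cut S1, min_cut S2 &
    crossing_number S1 + crossing_number S2 < crossing_number S + crossing_number S'].
Proof.
move=> kS kS' cr; have [fS _ [A hA]] := kS; have [fS' _ [B hB]] := kS'.
have [_ clA rA rA'] := hA; have [_ clB rB rB'] := hB.
have good : has_ray (A `&` B) -> has_ray (opposite S A `&` opposite S' B) ->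
    exists S1 S2, [/\ min_cut S1, min_cut S2 &
    crossing_number S1 + crossing_number S2 < crossing_number S + crossing_number S'].
  exact: uncross_corners.
have good' : has_ray (A `&` opposite S' B) -> has_ray (opposite S A `&` B) ->
    exists S1 S2, [/\ min_cut S1, min_cut S2 &
    crossing_number S1 + crossing_number S2 < crossing_number S + crossing_number S'].
  move=> h1 h2; apply: uncross_corners kS kS' cr hA (separationC hB) h1 _.
  apply: has_ray_sub h2 => x [nA Bx]; split=> // -[nB|S'x]; first by apply: nB; left.
  by case: hB => BS' _ _ _; apply: BS' Bx S'x.
case: (has_ray_split fS' clB rA) (has_ray_split fS' clB rA') => h [] h'; auto.
  (* Both rays found lie on the same side of [S']; a ray on its other side completes one of the two
     diagonals. *)
  by case: (has_ray_split fS clA rB'); rewrite setIC => h''; auto.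
by case: (has_ray_split fS clA rB); rewrite setIC => h''; auto.
Qed.

Definition optimal S :=
  min_cut S /\ forall T, min_cut T -> crossing_number S <= crossing_number T.

Lemma optimal_noncrossing S S' : optimal S -> optimal S' -> noncrossing S S'.
Proof.
move=> [kS oS] [kS' oS']; apply: contrapT => /(uncross kS kS')[S1 [S2 [k1 k2]]].
by rewrite ltnNge leq_add // ?oS ?oS'.
Qed.

Lemma ex_optimal S : min_cut S -> exists T, optimal T.
Proof.
move=> kS; pose P n := `[< exists2 T, min_cut T & crossing_number T = n >].
have exP : exists n, P n by exists (crossing_number S); apply/asboolP; exists S.
case: (ex_minnP exP) => n /asboolP[T kT <-] min; exists T; split=> // T' kT'.
by apply: min; apply/asboolP; exists T'.
Qed.

End MinimalCuts.
End Cuts.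

(** * A 2-distance-transitive graph with two ends has a cutvertex *)

Lemma isomorphism_inv (H K : graph) (f : H -> K) : isomorphism f ->
  exists g, [/\ isomorphism g, cancel f g & cancel g f].
Proof.
move=> [[g fg gf] fA]; exists g; split=> //; split; first by exists f.
by move=> x y; rewrite -fA !gf.
Qed.

Lemma csize_image T U (f : T -> U) (X : set T) :
  injective f -> finite_set X -> csize (f @` X) = csize X.
Proof.
move=> fi fX; apply: csize_eq => //; rewrite card_eq_sym.
by apply: inj_card_eq => x y _ _; apply: fi.
Qed.

Lemma reach_image (G H : graph) (a : G -> H) A B x y :
    (forall u v, adj u v -> adj (a u) (a v)) ->
  (forall u, A u -> B (a u)) -> reach A x y -> reach B (a x) (a y).
Proof.
move=> aA AB; elim=> [/AB|u v _ h /aA uv /AB]; first exact: reach_refl.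
exact: reach_step h uv.
Qed.

(** * Action of automorphisms on cuts and crossing numbers *)

Section Automorphism.
Variable G : graph.
Implicit Types (A S E C D : set G) (x y z v : G) (a b : G -> G).

(** Naming the inverse lets the image of a set under [a] be written as a preimage under [b], where
    membership unfolds by computation. *)
Definition inverse_automorphisms a b :=
  [/\ cancel a b, cancel b a,
      forall x y, adj (a x) (a y) = adj x y & forall x y, adj (b x) (b y) = adj x y].

Lemma inverse_automorphismsC a b :
  inverse_automorphisms a b -> inverse_automorphisms b a.
Proof. by case. Qed.

Lemma isomorphism_inverse a : isomorphism a -> exists b, inverse_automorphisms a b.
Proof.
move=> ia; have [b [ib ab ba]] := isomorphism_inv ia; exists b.
by case: ia ib => _ ? [_ ?].
Qed.

Lemma preimageK a b S : inverse_automorphisms a b -> a @^-1` (b @^-1` S) = S.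
Proof.
by move=> [ab _ _ _]; apply/seteqP; split=> x; rewrite /preimage /= ab.
Qed.

Lemma preimage_inj a b : inverse_automorphisms a b -> injective (preimage b).
Proof.
by move=> ab; apply: (can_inj (g := preimage a)) => S; apply: preimageK.
Qed.

Lemma preimage_imageE a b S : inverse_automorphisms a b -> b @^-1` S = a @` S.
Proof.
move=> [ab ba _ _]; apply/seteqP; split=> x; first by exists (b x).
by case=> y Sy <-; rewrite /preimage /= ab.
Qed.

Lemma has_ray_preimage a b A :
  inverse_automorphisms a b -> has_ray A -> has_ray (b @^-1` A).
Proof.
move=> [ab _ aA _] [r [[ri rA] Ar]]; exists (a \o r); split; last first.
  by move=> n; rewrite /preimage /= ab.
split; first by move=> i j /= /(can_inj ab)/ri.
by move=> n; rewrite /= aA.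
Qed.

Lemma end_cut_preimage a b S : inverse_automorphisms a b -> end_cut S -> end_cut (b @^-1` S).
Proof.
move=> ab [A [AS cl rA rA']]; have [_ _ _ bA] := ab; exists (b @^-1` A); split.
- by move=> x; apply: AS.
- by move=> x y Ax xy; apply: cl Ax _; rewrite bA.
- exact: (has_ray_preimage ab rA).
- exact: (has_ray_preimage ab rA').
Qed.

Lemma big_component_preimage a b S C : inverse_automorphisms a b ->
  big_component S C -> big_component (b @^-1` S) (b @^-1` C).
Proof.
move=> ab [[x [Sx eC]] rC]; split; last exact: (has_ray_preimage ab rC).
have [abK baK aA bA] := ab.
exists (a x); split; first by rewrite /preimage /= abK.
apply/seteqP; split=> y; rewrite /preimage /= eC => h.
  rewrite /component_of /= -(baK y); apply: reach_image h => u.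
    by move=> v; rewrite aA.
  by rewrite /preimage /= abK.
rewrite /component_of /= -(abK x); apply: reach_image h => u.
  by move=> v; rewrite bA.
by [].
Qed.

Section Cut.
Variable k : nat.

Lemma min_cut_preimage a b S : inverse_automorphisms a b ->
  min_cut k S -> min_cut k (b @^-1` S).
Proof.
move=> ab [fS <- eS]; have [abK _ _ _] := ab.
split; last exact: (end_cut_preimage ab eS).
  by rewrite (preimage_imageE _ ab); apply: finite_image.
by rewrite (preimage_imageE _ ab) csize_image //; apply: can_inj abK.
Qed.

Lemma noncrossing_preimage a b S E : inverse_automorphisms a b ->
  noncrossing S E -> noncrossing (b @^-1` S) (b @^-1` E).
Proof.
move=> ab [D hD DS]; exists (b @^-1` D); first exact: (big_component_preimage ab hD).
by move=> x; apply: DS.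
Qed.

Hypothesis k_min : forall S, finite_set S -> end_cut S -> k <= csize S.

Lemma crossing_number_preimage a b S : inverse_automorphisms a b ->
  min_cut k S -> crossing_number k (b @^-1` S) = crossing_number k S.
Proof.
move=> ab kS; have ba := inverse_automorphismsC ab.
rewrite /crossing_number -[RHS](csize_image (preimage_inj ab)); last exact: crossing_finite.
congr csize; apply/seteqP; split=> E.
  move=> [kE nc]; exists (a @^-1` E); last exact: preimageK ba.
  split; first exact: (min_cut_preimage ba).
  by move=> /(noncrossing_preimage ab); rewrite (preimageK E ba).
move=> [T [kT nc] <-]; split; first exact: (min_cut_preimage ab).
by move=> /(noncrossing_preimage ba); rewrite !(preimageK _ ab).
Qed.

Lemma optimal_preimage a b S : inverse_automorphisms a b ->
  optimal k S -> optimal k (b @^-1` S).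
Proof.
move=> ab [kS oS]; split; first exact: (min_cut_preimage ab kS).
by move=> T kT; rewrite (crossing_number_preimage ab kS); apply: oS.
Qed.

End Cut.
End Automorphism.

Section Distance.
Variable G : graph.
Implicit Types x y v : G.

Lemma distance0 x : distance x x 0.
Proof. by split=> //; exists [::]. Qed.

Lemma distance1 x y : adj x y -> distance x y 1.
Proof.
move=> xy; split; first by exists [:: y]; rewrite /= xy.
by move=> [|//] _ /= /(adj_neq xy).
Qed.

Lemma distance2 x v y : adj x v -> adj v y -> x <> y -> ~ adj x y ->
  distance x y 2.
Proof.
move=> xv vy nxy xy; split; first by exists [:: v; y]; rewrite /= xv vy.
by move=> [//|z [|//]] /=; rewrite andbT => xz zy; case: xy; rewrite -zy.
Qed.

End Distance.

(** * Optimal cuts under 2-distance-transitivity *)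

Section TwoDistanceTransitive.
Variable G : graph.
Hypothesis Gconn : connected (whole G).
Hypothesis Gdt : k_distance_transitive 2 G.
Implicit Types (A S T E C D : set G) (x y z v : G).

Lemma reachT x y : reach setT x y.
Proof. by apply/linked_induced; rewrite -wholeE; apply: Gconn.2. Qed.

Lemma end_cut_ne0 S : end_cut S -> S !=set0.
Proof.
move=> [A [AS cl [r [_ Ar]] [r' [_ nAr']]]]; apply: contrapT => S0.
have nS x : ~ S x by move=> Sx; apply: S0; exists x.
apply: (nAr' 0); left; apply: (reach_closed _ (reachT (r 0) (r' 0))) (Ar 0).
by move=> u v Au uv _; case: (cl u v Au uv) => // /nS.
Qed.

Lemma edge_transitive x y x' y' : adj x y -> adj x' y' ->
  exists a b, [/\ inverse_automorphisms a b, a x = x' & a y = y'].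
Proof.
move=> xy xy'; have [a [ia ax ay]] := Gdt (isT : 1 <= 2) (distance1 xy) (distance1 xy').
by have [b ab] := isomorphism_inverse ia; exists a, b.
Qed.

Lemma distance2_transitive x v y x' v' y' :
    adj x v -> adj v y -> x <> y -> ~ adj x y ->
    adj x' v' -> adj v' y' -> x' <> y' -> ~ adj x' y' ->
  exists a b, [/\ inverse_automorphisms a b, a x = x' & a y = y'].
Proof.
move=> xv vy nxy xy xv' vy' nxy' xy'.
have [a [ia ax ay]] := Gdt (isT : 2 <= 2) (distance2 xv vy nxy xy)
                                          (distance2 xv' vy' nxy' xy').
by have [b ab] := isomorphism_inverse ia; exists a, b.
Qed.

Fixpoint walk_in A n x y := match n with
  | 0 => A x /\ x = y
  | n.+1 => A x /\ exists2 z, adj x z & walk_in A n z y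
  end.

Lemma reach_walk A x y : reach A x y -> exists n, walk_in A n x y.
Proof.
move=> /reach_sym; elim=> [Ay|u v _ [n h] uv Av]; first by exists 0.
by exists n.+1; split=> //; exists u; rewrite // adjC.
Qed.

(** The first exit of the walk, prolonged by [t], from [F]. The bound on what remains after the exit
    is what contradicts minimality in [handle_descent]. *)
Lemma walk_exit A F S n x y t : walk_in A n x y -> adj y t -> F x -> ~ F t ->
    (forall u v, F u -> adj u v -> F v \/ S v) ->
  exists m z w, [/\ m <= n, walk_in F m x z, adj z w, S w &
    w = t \/ exists2 j, j < n & walk_in A j w y].
Proof.
move=> xy yt Fx nFt cl; elim: n x xy Fx => [|n IH] x /=.
  move=> [_ ->] Fy; exists 0, y, t; split=> //; last by left.
  by case: (cl y t Fy yt).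
move=> [Ax [u xu uy]] Fx; have [Su|nSu] := pselect (F u); last first.
  exists 0, x, u; split=> //; first by case: (cl x u Fx xu).
  by right; exists n.
have [m [z [w [mn uz zw Sw wt]]]] := IH u uy Su.
exists m.+1, z, w; split=> //; first by split=> //; exists u.
by case: wt => [->|[j jn wy]]; [left | right; exists j => //; apply: ltnW].
Qed.

Section Cut.
Variable k : nat.
Hypothesis k_min : forall S, finite_set S -> end_cut S -> k <= csize S.
Hypothesis ex_min_cut : exists S, min_cut k S.

Lemma optimal_min_cut S : optimal k S -> min_cut k S. Proof. by case. Qed.

Lemma optimal_sides S : optimal k S -> exists s C D c d,
  [/\ big_component S C, big_component S D, C <> D &
      [/\ S s, C c, D d, adj s c & adj s d]].
Proof.
move=> [kS _]; have [_ _ eS] := kS; have [s Ss] := end_cut_ne0 eS.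
have [C [D [hC hD CD]]] := end_cut_big eS.
have [c Cc sc] := min_cut_full k_min kS hC Ss.
have [d Dd sd] := min_cut_full k_min kS hD Ss.
by exists s, C, D, c, d.
Qed.

Lemma opposite_sides S C D c d : big_component S C -> big_component S D -> C <> D ->
  C c -> D d -> c <> d /\ ~ adj c d.
Proof.
move=> hC hD CD Cc Dd; split=> [e|cd].
  by apply: (big_component_disj hC hD CD Cc); rewrite e.
case: (big_component_closed hC Cc cd) => [Cd|].
  exact: big_component_disj hC hD CD Cd Dd.
exact: big_component_notin hD Dd.
Qed.

Lemma distance2_separated x v y : adj x v -> adj v y -> x <> y -> ~ adj x y ->
  exists S C D, [/\ optimal k S, big_component S C, big_component S D, C <> D &
    C x /\ D y].
Proof.
move=> xv vy nxy xy; have [S0 kS0] := ex_min_cut; have [S oS] := ex_optimal kS0.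
have [s [C [D [c [d [hC hD CD [Ss Cc Dd sc sd]]]]]]] := optimal_sides oS.
have [ncd cd] := opposite_sides hC hD CD Cc Dd; rewrite adjC in sc.
have [a [b [ab ac ad]]] := distance2_transitive sc sd ncd cd xv vy nxy xy.
have [abK baK _ _] := ab.
exists (b @^-1` S), (b @^-1` C), (b @^-1` D); split.
- exact: (optimal_preimage k_min ab).
- exact: (big_component_preimage ab).
- exact: (big_component_preimage ab).
- by move=> /(preimage_inj ab).
- by rewrite /preimage /= -ac -ad !abK.
Qed.

(** An optimal [T] separating [s] from [t] would, by nestedness, have all of [S] in [T] and a single
    ray component of G - T. *)
Lemma optimal_no_distance2 S s v t : optimal k S -> S s -> S t ->
  adj s v -> adj v t -> s <> t -> adj s t.
Proof.
move=> oS Ss St sv vt nst; apply: contrapT => nadj.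
have [T [C [D [oT hC hD CD [Cs Dt]]]]] := distance2_separated sv vt nst nadj.
have [F hF SF] := noncrossing_side k_min (optimal_min_cut oT) (optimal_min_cut oS)
                                   (optimal_noncrossing k_min oT oS).
have FC : F = C.
  by case: (SF s Ss) => [Fs|/(big_component_notin hC Cs)//]; apply: (big_component_eq hF hC Fs Cs).
have FD : F = D.
  by case: (SF t St) => [Ft|/(big_component_notin hD Dt)//]; apply: (big_component_eq hF hD Ft Dt).
by apply: CD; rewrite -FC.
Qed.

(** [n] counts only the edges between [c] and [c']: the walk from [s] to [t] has [n] + 2 edges, and
    [handle 0] provides a common neighbour. *)
Definition handle n := exists S C s t c c', [/\ optimal k S, big_component S C,
  S s /\ S t, s <> t & [/\ adj s c, adj c' t & walk_in C n c c']].

(* A shortest walk through a component between two vertices of an optimal cut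
   has length 2: otherwise the cut separating its first and third vertices
   yields a shorter one. *)
Lemma handle_descent n : handle n.+1 -> exists2 m, m <= n & handle m.
Proof.
move=> [S [C [s [t [c [c' [oS hC [Ss St] nst [sc ct [Cc [c2 cc2 w2]]]]]]]]]].
have [//|no] := pselect (exists2 m, m <= n & handle m).
have shorter j e : j <= n -> adj s e -> ~ walk_in C j e c'.
  by move=> jn se we; apply: no; exists j => //; exists S, C, s, t, e, c'.
have Cc2 : C c2 by case: n w2 {no shorter} => [|n] [].
have nsc2 : s <> c2 by move=> e; apply: (big_component_notin hC Cc2); rewrite -e.
have sc2 : ~ adj s c2 by move=> /(shorter n _ (leqnn n)).
have [T [E [F [oT hE hF EF [Es Fc2]]]]] := distance2_separated sc cc2 nsc2 sc2.
(* [c] is adjacent to vertices in two different components of G - T. *)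
have Tc : T c.
  case: (big_component_closed hE Es sc) => // Ec.
  case: (big_component_closed hF Fc2 (_ : adj c2 c)) => //; first by rewrite adjC.
  by move=> Fc; case: (big_component_disj hE hF EF Ec Fc).
have [E' hE' SE'] := noncrossing_side k_min (optimal_min_cut oT) (optimal_min_cut oS)
                                   (optimal_noncrossing k_min oT oS).
have nFt : ~ F t.
  move=> Ft; case: (SE' t St) => [E't|]; last exact: big_component_notin hF Ft.
  case: (SE' s Ss) => [E's|]; last exact: big_component_notin hE Es.
  apply: EF; rewrite -(big_component_eq hE' hE E's Es).
  exact: (big_component_eq hE' hF E't Ft).
(* [c2] lies in [F] and [t] does not, so the walk leaves [F] at some [w] in [T]. The part inside [F]
   joins [c] and [w], two vertices of [T], and is the shorter handle. *)
have [m [z [w [mn wF zw Tw wt]]]] := walk_exit w2 ct Fc2 nFt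
  (fun u v => @big_component_closed _ _ _ _ _ hF).
exists m => //; exists T, F, c, w, c2, z; split=> //.
case: wt => [-> cw|[j jn wc'] cw].
  by apply: (big_component_notin hC Cc); rewrite cw.
by apply: (shorter j w) (ltnW jn) _ wc'; rewrite -cw.
Qed.

Lemma handle0 n : handle n -> handle 0.
Proof.
elim/ltn_ind: n => -[//|n] IH /handle_descent[m mn].
by apply: IH; rewrite ltnS.
Qed.

Lemma edge_in_optimal x y : 1 < k -> adj x y ->
  exists S, [/\ optimal k S, S x & S y].
Proof.
move=> k1 xy; have [S0 kS0] := ex_min_cut; have [S oS] := ex_optimal kS0.
have kS := optimal_min_cut oS; have [fS Sk eS] := kS; have [s Ss] := end_cut_ne0 eS.
have [t [St ts]] : (S `\ s) !=set0.
  apply/set0P/eqP => Ss0; move: k1.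
  by rewrite -Sk (csizeD1 fS Ss) Ss0 csize0.
have [C [D [hC hD CD]]] := end_cut_big eS.
have [c Cc sc] := min_cut_full k_min kS hC Ss.
have [c' Cc' tc'] := min_cut_full k_min kS hC St.
have [n wn] := reach_walk (big_component_reach hC Cc Cc').
have : handle n.
  exists S, C, s, t, c, c'; split=> //; first by move=> e; apply: ts.
  by split=> //; rewrite adjC.
move=> /handle0[T [E [u [v [e [e' [oT hE [Tu Tv] uv [ue ev [_ ee']]]]]]]]].
rewrite -ee' in ev; have auv := optimal_no_distance2 oT Tu Tv ue ev uv.
have [a [b [ab au av]]] := edge_transitive auv xy.
exists (b @^-1` T); split; first exact: (optimal_preimage k_min ab).
  by case: ab => abK _ _ _; rewrite /preimage /= -au abK.
by case: ab => abK _ _ _; rewrite /preimage /= -av abK.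
Qed.

Definition separating x y T := optimal k T /\ exists C D,
  [/\ big_component T C, big_component T D, C <> D & C x /\ D y].

Lemma finite_separating x y : finite_set (separating x y).
Proof.
apply: sub_finite_set (finite_min_separators k setT x y).
move=> T [oT [C [D [hC hD CD [Cx Dy]]]]].
have kT := optimal_min_cut oT; have [fT Tk eT] := kT; split=> //.
exact: (min_cut_min_separator k_min kT hC hD CD Cx Dy).
Qed.

(** [X] collects optimal cuts having the whole current component [C] on one side and [d] on the
    other. A neighbour of [s] in [C] is thus at distance 2 from [d] and separated from it by all of
    [X]. *)
Definition nested_cuts n := exists S C D s d (X : set (set G)),
  [/\ optimal k S, big_component S C, big_component S D, C <> D &
    [/\ S s, adj s d, D d, finite_set X & csize X = n /\
      forall T, X T -> optimal k T /\ exists C0 D0,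
        [/\ big_component T C0, big_component T D0, C0 <> D0, C `<=` C0 & D0 d]]].

Lemma nested_cuts0 : nested_cuts 0.
Proof.
have [S0 kS0] := ex_min_cut; have [S oS] := ex_optimal kS0.
have [s [C [D [c [d [hC hD CD [Ss Cc Dd sc sd]]]]]]] := optimal_sides oS.
by exists S, C, D, s, d, set0; split=> //; split=> //; split; [exact: csize0|].
Qed.

(** An optimal cut [T] through the edge from [s] to some [c] in [C] avoids [D] and has a ray
    component [E] inside [C], which replaces [C]; [s] and [d] are kept. [T] is new because it
    contains [c], while members of [X] have [c] in one of their components. *)
Lemma nested_cutsS n : 1 < k -> nested_cuts n -> nested_cuts n.+1.
Proof.
move=> k1 [S [C [D [s [d [X [oS hC hD CD [Ss sd Dd fX [Xn hX]]]]]]]]].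
have kS := optimal_min_cut oS; have [c Cc sc] := min_cut_full k_min kS hC Ss.
have [T [oT Ts Tc]] := edge_in_optimal k1 sc; have kT := optimal_min_cut oT.
have DT x : D x -> ~ T x.
  have [C1 hC1 TC1] := noncrossing_side k_min kS kT (optimal_noncrossing k_min oS oT).
  have CC1 : C = C1.
    case: (TC1 c Tc) => [C1c|/(big_component_notin hC Cc)//].
    exact: (big_component_eq hC hC1 Cc C1c).
  move=> Dx /TC1[|/(big_component_notin hD Dx)//]; rewrite -CC1 => Cx.
  exact: (big_component_disj hC hD CD Cx Dx).
have [D' hD' DD'] := big_component_sup hD DT.
have [E hE ES] := optimal_noncrossing k_min oS oT.
have [e Ee ce] := min_cut_full k_min kT hE Tc.
have [C' hC' EC'] := big_component_sup hE ES.
have C'C : C' = C.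
  case: (big_component_closed hC Cc ce) => [Ce|/(ES e Ee)//].
  exact: (big_component_eq hC' hC (EC' e Ee) Ce).
rewrite C'C in EC'.
have ED' : E <> D'.
  move=> eED; apply: (big_component_disj hC hD CD _ Dd); apply: EC'.
  by rewrite eED; apply: DD'.
have nXT : ~ X T.
  by move=> /hX[_ [C0 [D0 [hC0 _ _ CC0 _]]]]; apply: (big_component_notin hC0 (CC0 c Cc)).
exists T, E, D', s, d, (X `|` [set T]); split=> //; split=> //; first exact: DD'.
  by rewrite finite_setU.
split.
  have TX : X `&` [set T] = set0 by apply/seteqP; split=> // U [XU UT]; apply: nXT; rewrite -UT.
  have := csizeUI fX (finite_set1 T); rewrite TX csize0 addn0 Xn => ->.
  by have [_ ->] := (csizeP [set T] 1).1 card_set1; rewrite addn1.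
move=> U [/hX[oU [C0 [D0 [h1 h2 h3 h4 h5]]]]|->]; split=> //.
  by exists C0, D0; split=> //; apply: subset_trans h4.
by exists E, D'; split=> //; apply: DD'.
Qed.

(** The bound is uniform: any pair produced by [nested_cuts] can be moved to one fixed pair [c], [d]
    at distance 2, so one cut more than separate this pair is too many. *)
Lemma k_le1 : k <= 1.
Proof.
rewrite leqNgt; apply/negP => k1.
have [S0 kS0] := ex_min_cut; have [S oS] := ex_optimal kS0.
have [s [C [D [c [d [hC hD CD [Ss Cc Dd sc sd]]]]]]] := optimal_sides oS.
have [ncd cd] := opposite_sides hC hD CD Cc Dd; rewrite adjC in sc.
have : nested_cuts (csize (separating c d)).+1.
  by elim: _.+1 => [|n]; [exact: nested_cuts0 | exact: nested_cutsS].
move=> [S' [C' [D' [s' [d' [X [oS' hC' hD' CD' [Ss' sd' Dd' fX [Xn hX]]]]]]]]].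
have [c' Cc' sc'] := min_cut_full k_min (optimal_min_cut oS') hC' Ss'.
have [ncd' cd'] := opposite_sides hC' hD' CD' Cc' Dd'; rewrite adjC in sc'.
have [a [b [ab ac ad]]] := distance2_transitive sc' sd' ncd' cd' sc sd ncd cd.
have [abK _ _ _] := ab.
have : csize (preimage b @` X) <= csize (separating c d).
  apply: csize_le; first exact: finite_separating.
  move=> _ [T XT <-]; have [oT [C0 [D0 [hC0 hD0 CD0 CC0 Dd0]]]] := hX T XT.
  split; first exact: (optimal_preimage k_min ab).
  exists (b @^-1` C0), (b @^-1` D0); split.
  - exact: (big_component_preimage ab).
  - exact: (big_component_preimage ab).
  - by move=> /(preimage_inj ab).
  - by rewrite /preimage /= -ac -ad !abK; split=> //; apply: CC0.
by rewrite (csize_image (preimage_inj ab)) // Xn ltnn.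
Qed.

End Cut.

Lemma ex_local_cutvertex : (exists2 S : set G, finite_set S & end_cut S) ->
  exists v x y, [/\ adj v x, adj v y & ~ reach (~` [set v]) x y].
Proof.
move=> [S0 fS0 eS0].
pose P n := `[< exists S : set G, [/\ finite_set S, csize S = n & end_cut S] >].
have exP : exists n, P n by exists (csize S0); apply/asboolP; exists S0.
case: (ex_minnP exP) => k /asboolP[S kS] min.
have k_min T : finite_set T -> end_cut T -> k <= csize T.
  by move=> fT eT; apply: min; apply/asboolP; exists T.
have := k_le1 k_min (ex_intro _ S kS) => k1.
have [fS Sk eS] := kS; have [v Sv] := end_cut_ne0 eS.
have Sv1 x : S x <-> x = v.
  split=> [Sx|->//]; apply: contrapT => xv.
  move: k1; rewrite -Sk (csizeD1 fS Sv) ltnS leqn0 => /eqP.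
  by move=> /(csize_eq0 (finite_setD _ fS)) e; have : (S `\ v) x by []; rewrite e.
have Sv2 : S = [set v] by apply/seteqP; split=> x /Sv1.
have [C [D [hC hD CD]]] := end_cut_big eS.
have [c Cc vc] := min_cut_full k_min kS hC Sv; have [d Dd vd] := min_cut_full k_min kS hD Sv.
exists v, c, d; split=> //; rewrite -Sv2 => cd.
by apply: (big_component_disj hC hD CD _ Dd); rewrite (big_component_of hC Cc).
Qed.

End TwoDistanceTransitive.

(** * Blocks and cliques *)

Lemma card_ge2P T (A : set T) :
  `I_2 #<= A <-> exists x y, [/\ A x, A y & x <> y].
Proof.
split=> [/card_leP[f]|[x [y [Ax Ay xy]]]].
  have i0 : 0 \in `I_2 by rewrite inE.
  have i1 : 1 \in `I_2 by rewrite inE.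
  exists (set_val (f (SigSub i0))), (set_val (f (SigSub i1))).
  split; [exact: set_valP | exact: set_valP|].
  by move=> /val_inj /(@inj _ _ _ f); rewrite !inE => /(_ I I) [].
pose f n := if n is 0 then x else y.
have fi : {in `I_2 &, injective f}.
  move=> [|[|i]] [|[|j]]; rewrite ?inE //= => _ _; by move=> e; case: xy.
rewrite -(card_le_eql (inj_card_eq fi)).
by apply: subset_card_le => _ [[|n] _ <-].
Qed.

Section Blocks.
Variable G : graph.
Implicit Types (A P : set G) (x y z v w : G) (H K B : subgraph G).

Definition cutvertex_free H := connected H /\ forall v, ~ cutvertex H v.

Definition clique A := forall x y, A x -> A y -> x <> y -> adj x y.

Lemma clique_reach A x y : clique A -> A x -> A y -> reach A x y.
Proof.
move=> cA Ax Ay; have [->|xy] := pselect (x = y); first exact: reach_refl.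
by apply: reach_edge => //; apply: cA.
Qed.

Lemma clique_cutvertex_free A : clique A -> A !=set0 -> cutvertex_free (induced A).
Proof.
move=> cA A0; split; first by apply/reach_connected; split=> // x y; apply: clique_reach.
move=> v [_ [x [y [xv yv xy]]]]; apply.
rewrite del_inducedE; apply/linked_induced/clique_reach.
- by move=> u w [Au _] [Aw _]; apply: cA.
- by split=> //; case: xy.
- by split=> //; move/linked_vert: xy.
Qed.

Lemma cutvertex_free_del H v x y : cutvertex_free H ->
  vert H x -> vert H y -> x <> v -> y <> v -> linked (del H [set v]) x y.
Proof.
move=> [[_ cH] nc] Hx Hy xv yv; apply: contrapT => nl.
have [Hv|Hv] := pselect (vert H v).
  by apply: (nc v); split=> //; exists x, y; split=> //; apply: cH.
apply: nl; apply: linked_sub (cH x y Hx Hy).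
split; first by move=> z Hz; split=> // zv; rewrite -zv in Hv.
move=> z w zw; apply/delE; split=> // e; apply: Hv; rewrite -e.
  exact: edge_vert zw.
exact: edge_vertr zw.
Qed.

(* The union of all cutvertex-free subgraphs through x and y is again
   cutvertex-free, since removing a vertex keeps x or y in all of them. *)
Section UnionThrough.
Variables x y : G.

Let through K := [/\ cutvertex_free K, vert K x & vert K y].

Let union_edge u v := `[< exists2 K, through K & edge K u v >].

Let union_sym : symmetric union_edge.
Proof.
by move=> u v; apply: asbool_equiv_eq; split=> -[K tK]; rewrite edge_sym; exists K.
Qed.

Let union_adj u v : union_edge u v -> adj u v.
Proof. by move=> /asboolP[K _]; apply: edge_adj. Qed.

Let union_vert u v : union_edge u v -> [set z | exists2 K, through K & vert K z] u.
Proof. by move=> /asboolP[K tK /edge_vert Ku]; exists K. Qed.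

Let union := Subgraph union_sym union_adj union_vert.

Let sub_union K : through K -> sub K union.
Proof.
move=> tK; split; first by move=> z Kz; exists K.
by move=> u v uv; apply/asboolP; exists K.
Qed.

Let sub_del K v : sub K union -> sub (del K [set v]) (del union [set v]).
Proof.
move=> [sv se]; split; first by move=> z [/sv].
by move=> z w /delE[/se zw zv wv]; apply/delE.
Qed.

Lemma sub_block H : x <> y -> cutvertex_free H -> vert H x -> vert H y ->
  exists2 B, block B & sub H B.
Proof.
move=> xy fH Hx Hy; have tH : through H by [].
exists union; last exact: sub_union.
split.
  split.
    split; first by exists x, H.
    move=> u w [K tK Ku] [K' tK' K'w]; apply: (@linked_trans _ _ x).
      by apply: linked_sub (sub_union tK) _; case: tK => [[[_ cK] _] Kx _]; apply: cK.
    by apply: linked_sub (sub_union tK') _; case: tK' => [[[_ cK] _] Kx _]; apply: cK.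
  move=> v [_ [u [w [uv wv uw]]]]; apply.
  have [K tK Ku] := uw.1; have [K' tK' K'w] := linked_vert uw.
  have [xv|xv] := pselect (x = v).
    have yv : y <> v by rewrite -xv => /esym.
    apply: (@linked_trans _ _ y).
      apply: linked_sub (sub_del v (sub_union tK)) _.
      by case: tK => fK _ Ky; apply: cutvertex_free_del.
    apply: linked_sub (sub_del v (sub_union tK')) _.
    by case: tK' => fK _ Ky; apply: cutvertex_free_del.
  apply: (@linked_trans _ _ x).
    apply: linked_sub (sub_del v (sub_union tK)) _.
    by case: tK => fK Kx _; apply: cutvertex_free_del.
  apply: linked_sub (sub_del v (sub_union tK')) _.
  by case: tK' => fK Kx _; apply: cutvertex_free_del.
move=> K fK [sv se]; apply: sub_anti; last by [].
by apply: sub_union; split=> //; apply: sv; exists H.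
Qed.

End UnionThrough.

(** The minimal set plays the role of an induced path without ordering its vertices. *)
Lemma reach_minimal A x y : reach A x y -> exists P,
  [/\ finite_set P, P `<=` A, reach P x y &
      forall Q, Q `<=` P -> reach Q x y -> Q = P].
Proof.
move=> /reach_finite[P0 fP0 [P0A xPy]].
pose p n := `[< exists P, [/\ P `<=` P0, reach P x y & csize P = n] >].
have exP : exists n, p n.
  by exists (csize P0); apply/asboolP; exists P0; split.
case: (ex_minnP exP) => n /asboolP[P [PP0 xy Pn]] min.
have fP := sub_finite_set PP0 fP0.
exists P; split=> //; first exact: subset_trans P0A.
move=> Q QP xQy; apply/seteqP; split=> // z Pz; apply: contrapT => nQz.
have := csize_lt fP QP Pz nQz; rewrite Pn ltnNge min //.
by apply/asboolP; exists Q; split=> //; apply: subset_trans PP0.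
Qed.

(* In a minimal set P containing an x-y walk every vertex stays connected to x
   or to y when another vertex w is removed: a component missing both x and y
   would be entered and left through w only, hence could be dropped from P. *)
Lemma minimal_reach_del P x y w z :
    (forall Q, Q `<=` P -> reach Q x y -> Q = P) -> reach P x y ->
    P z -> z <> w ->
  reach (P `\ w) z x \/ reach (P `\ w) z y.
Proof.
move=> min xy Pz zw; apply: contrapT => /not_orP[nx ny].
pose Q := P `\` [set u | reach (P `\ w) z u].
suff Qxy : reach Q x y.
  have eQ := min Q (@subDsetl _ _ _) Qxy.
  have [_] : Q z by rewrite eQ.
  by apply; apply: reach_refl.
have Qx : Q x by split=> //; apply: reach_src xy.
suff key t : reach P x t -> (~ reach (P `\ w) z t -> reach Q x t) /\
    (reach (P `\ w) z t -> reach Q x w) by apply: (key y xy).1.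
elim=> [_|u v xu [IH1 IH2] uv Pv]; first by split=> // _; apply: reach_refl.
have [zu|nzu] := pselect (reach (P `\ w) z u); split=> zv.
- have [vw|vw] := pselect (v = w); first by rewrite vw; apply: IH2.
  by case: zv; apply: reach_step zu uv _.
- exact: IH2.
- by apply: reach_step (IH1 nzu) uv _.
- have [uw|uw] := pselect (u = w); first by rewrite -uw; apply: IH1.
  case: nzu; apply: reach_step zv _ _; first by rewrite adjC.
  by split=> //; apply: reach_tgt xu.
Qed.

(** A cycle through [v], possibly with chords at [v]. Without [v] the set [P] is still connected;
    without another [w], each vertex still reaches [x] or [y], and hence [v]. *)
Lemma cycle_cutvertex_free v x y P : adj v x -> adj v y -> x <> y ->
    ~ P v -> reach P x y -> (forall Q, Q `<=` P -> reach Q x y -> Q = P) ->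
  cutvertex_free (induced (P `|` [set v])).
Proof.
move=> vx vy xy nPv rxy min; set A := P `|` [set v].
have Px := reach_src rxy; have Py := reach_tgt rxy.
have PA : P `<=` A by left.
have toP z : P z -> reach P x z.
  (* [component_of] of the complement of [P] is what [x] reaches inside [P]; it already carries a
     walk to [y], so minimality makes it all of [P]. *)
  have e : P `&` component_of (~` P) x = P.
    apply: min => [u []//|]; apply: reach_in rxy _ => [u u' [Pu xu] uu' Pu'|].
      by split=> //; rewrite /component_of /= setCK in xu *; apply: reach_step xu uu' Pu'.
    by split=> //; rewrite /component_of /= setCK; apply: reach_refl.
  by rewrite -{1}e => -[_]; rewrite /component_of /= setCK.
have Av : A v by right.
have tov z : A z -> reach A v z.
  case=> [/toP h|->]; last exact: reach_refl.
  apply: (@reach_trans _ _ x); last exact: reach_sub h.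
  by apply: reach_edge => //; apply: PA.
split.
  apply/reach_connected; split; first by exists v.
  move=> u w /tov /reach_sym uv /tov; exact: reach_trans.
move=> w [Aw [u [u' [uw uw' uu']]]]; apply.
have Au := uu'.1; have Au' := linked_vert uu'.
rewrite del_inducedE; apply/linked_induced.
have [wv|wv] := pselect (w = v).
  have sPA : P `<=` A `\ w by move=> s Ps; split; [left | rewrite wv => sv; rewrite -sv in nPv].
  have toP' z : A z -> z <> w -> P z by case=> // ->; rewrite wv.
  apply: (@reach_trans _ _ x); apply: reach_sub sPA _; last exact/toP/toP'.
  exact/reach_sym/toP/toP'.
have sPA : P `\ w `<=` A `\ w by move=> s [Ps sw]; split=> //; left.
suff tov' z : A z -> z <> w -> reach (A `\ w) z v.
  by apply: (reach_trans (tov' _ Au uw)); apply/reach_sym/tov'.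
case=> [Pz zw|->]; last by move=> _; apply: reach_refl; split=> // /esym.
have Avw : (A `\ w) v by split=> // /esym.
by case: (minimal_reach_del min rxy Pz zw) => h;
  apply: (reach_step (reach_sub sPA h) _ Avw); rewrite adjC.
Qed.

Lemma sub_block_cycle v x y : adj v x -> adj v y -> x <> y ->
  reach (~` [set v]) x y -> exists B, [/\ block B, vert B v, vert B x & vert B y].
Proof.
move=> vx vy xy /reach_minimal[P [fP Pv rxy min]].
have fH := cycle_cutvertex_free vx vy xy (fun h => Pv v h erefl) rxy min.
have [||B bB [sv _]] := sub_block xy fH; first by left; apply: reach_src rxy.
  by left; apply: reach_tgt rxy.
exists B; split=> //; apply: sv; first by right.
  by left; apply: reach_src rxy.
by left; apply: reach_tgt rxy.
Qed.

End Blocks.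

(* The maximal clique through the edge xy, when neighbours of a vertex are
   adjacent as soon as that vertex does not separate them. *)
Definition edge_clique (G : graph) (x y : G) : set G :=
  [set z | (z = x \/ adj x z) /\ (z = y \/ adj y z)].

Definition neighbours_separated (G : graph) := forall v x y : G,
  adj v x -> adj v y -> x <> y -> reach (~` [set v]) x y -> adj x y.

Definition cliques_at (G : graph) (v : G) : set (set G) :=
  [set edge_clique v y | y in [set y | adj v y]].

(** [is_X] in terms of vertex sets: maximal cliques stand for blocks. Connectivity 1 is recovered
    from [L] having two elements. *)
Definition clique_tree (K L : Type) (G : graph) :=
  [/\ connected (whole G), neighbours_separated G,
      forall x y : G, adj x y -> edge_clique x y #= [set: K] &
      forall v : G, cliques_at v #= [set: L]].

(** * Maximal cliques as blocks *)

Section CliqueTree.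
Variable G : graph.
Implicit Types (A P : set G) (x y z v w : G) (H K B : subgraph G).

Lemma edge_clique_l x y : adj x y -> edge_clique x y x.
Proof. by move=> xy; split; [left | right; rewrite adjC]. Qed.

Lemma edge_clique_r x y : adj x y -> edge_clique x y y.
Proof. by move=> xy; split; [right | left]. Qed.

Lemma clique_sub_edge_clique A x y : clique A -> A x -> A y -> A `<=` edge_clique x y.
Proof.
move=> cA Ax Ay z Az; split.
  by have [->|zx] := pselect (z = x); [left | right; apply: cA => // /esym].
by have [->|zy] := pselect (z = y); [left | right; apply: cA => // /esym].
Qed.

Section Separated.
Hypothesis Gsep : neighbours_separated G.

Lemma edge_clique_clique x y : adj x y -> clique (edge_clique x y).
Proof.
move=> xy z w [zx zy] [wx wy] zw.
case: zx zw => [->|zx] zw; first by case: wx => // wx; case: zw.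
case: wx => [->|wx]; first by rewrite adjC.
have nx u : adj x u -> (~` [set x]) u by move=> xu e; apply: (adj_neq xu).
apply: (Gsep zx wx) => //; apply: (@reach_trans _ _ y).
  case: zy => [->|zy]; first exact/reach_refl/nx.
  by apply/reach_sym/reach_edge => //; apply: nx.
case: wy => [->|wy]; first exact/reach_refl/nx.
by apply: reach_edge => //; apply: nx.
Qed.

(** Along a walk from [x], neighbours of [x] can only be followed by [x] or its neighbours: a vertex
    [z] after [y] not adjacent to [x] would be separated from [x] by [y], making [y] a cutvertex. *)
Lemma cutvertex_free_clique B : cutvertex_free B -> clique (vert B).
Proof.
move=> [[_ cB] nc] x y Bx By nxy.
suff : y = x \/ adj x y by case=> // yx; case: nxy.
move: (cB x y Bx By) => {By nxy}; move: y.
apply: linked_ind => [|y z xy [yx|axy] yz]; first by left.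
  by right; rewrite -yx; apply: edge_adj yz.
have [->|xz] := pselect (z = x); [by left | right].
apply: contrapT => naxz; apply: (nc y); split; first exact: linked_vert xy.
exists x, z; split.
- exact: adj_neq.
- by move/esym; apply: adj_neq; apply: edge_adj yz.
- exact: linked_step xy yz.
move=> /(linked_sub (del_induced _ (@subsetT _ _)))/linked_induced.
rewrite setTD => xzy; apply: naxz; apply: Gsep xzy; first by rewrite adjC.
  exact: edge_adj yz.
by move/esym.
Qed.

Lemma edge_clique_block x y : adj x y -> block (induced (edge_clique x y)).
Proof.
move=> xy; split.
  apply: clique_cutvertex_free; first exact: edge_clique_clique.
  by exists x; apply: edge_clique_l.
move=> K fK [sv se]; apply: sub_anti; last by split.
apply/sub_induced/clique_sub_edge_clique; first exact: cutvertex_free_clique.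
  by apply: sv; apply: edge_clique_l.
by apply: sv; apply: edge_clique_r.
Qed.

Lemma block_edge_clique B v : (exists y, adj v y) -> block B -> vert B v ->
  exists2 y, adj v y & B = induced (edge_clique v y).
Proof.
move=> [y vy] [fB maxB] Bv; have cB := cutvertex_free_clique fB.
suff [w vw Bw] : exists2 w, adj v w & vert B `<=` edge_clique v w.
  exists w => //; apply/esym/maxB; last by apply/sub_induced.
  by have [] := edge_clique_block vw.
have [[w [Bw wv]]|no] := pselect (exists w, vert B w /\ w <> v).
  have vw : adj v w by apply: cB => // /esym.
  by exists w => //; apply: clique_sub_edge_clique.
(* If [v] is the only vertex of [B], any clique at [v] contains [B], and maximality again gives
   equality. *)
exists y => // z Bz; have -> : z = v by apply: contrapT => zv; apply: no; exists z.
exact: edge_clique_l.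
Qed.

Lemma blocks_at v : (exists y, adj v y) ->
  [set B : subgraph G | block B /\ vert B v] = (@induced G) @` cliques_at v.
Proof.
move=> ne; apply/seteqP; split=> B.
  move=> [bB /(block_edge_clique ne bB)[y vy ->]].
  by exists (edge_clique v y); first by exists y.
move=> [_ [y vy <-] <-]; split; first exact: edge_clique_block.
exact: edge_clique_l.
Qed.

Lemma card_blocks_at v : (exists y, adj v y) ->
  [set B : subgraph G | block B /\ vert B v] #= cliques_at v.
Proof.
move=> /blocks_at ->; apply: inj_card_eq => A A' _ _ e.
by have := congr1 (@vert G) e.
Qed.

End Separated.

Lemma connected_neighbour x : connected (whole G) -> `I_2 #<= [set: G] ->
  exists y, adj x y.
Proof.
move=> Gc /card_ge2P[u [v [_ _ uv]]].
have [w xw] : exists w, x <> w.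
  have [xu|xu] := pselect (x = u); last by exists u.
  by exists v; rewrite xu.
apply: contrapT => no; apply: xw; apply/esym.
have xw := Gc.2 x w I I; move: w xw; apply: linked_ind => // y z _ -> xz.
by case: no; exists z.
Qed.

Lemma is_X_clique_tree (K L : Type) : is_X K L G -> clique_tree K L G.
Proof.
move=> [Gc [[G2 _] _] bl bv].
have sep : neighbours_separated G.
  move=> v x y vx vy nxy /(sub_block_cycle vx vy nxy)[B [bB _ Bx By]].
  by have [_ /(_ _ _ Bx By nxy)/edge_adj] := bl B bB.
split=> //.
  by move=> x y xy; have [] := bl _ (edge_clique_block sep xy).
move=> v; rewrite -(card_eql (card_blocks_at sep _)) //.
exact: connected_neighbour.
Qed.

Lemma edge_clique_eq x y z : neighbours_separated G -> adj x y -> adj x z ->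
  edge_clique x y z -> edge_clique x z = edge_clique x y.
Proof.
move=> sep xy xz [_ zy]; apply/seteqP; split; apply: clique_sub_edge_clique.
- exact: edge_clique_clique.
- exact: edge_clique_l.
- by split; [right | case: zy => [->|zy]; [left | right; rewrite adjC]].
- exact: edge_clique_clique.
- exact: edge_clique_l.
- by split; [right|].
Qed.

Lemma clique_tree_neighbour (K L : Type) v : clique_tree K L G -> `I_2 #<= [set: L] ->
  exists x y, [/\ adj v x, adj v y, x <> y & ~ adj x y].
Proof.
move=> [_ sep _ cv] L2; have := cv v; move/(card_le_eqr (C := `I_2)).
rewrite L2 => /card_ge2P[_ [_ [[x vx <-] [y vy <-] xy]]].
exists x, y; split=> // [e|axy]; apply: xy; first by rewrite e.
apply/esym; apply: edge_clique_eq => //.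
by split; right.
Qed.

Lemma clique_tree_is_X (K L : Type) : clique_tree K L G ->
  `I_2 #<= [set: L] -> is_X K L G.
Proof.
move=> ct L2; have [Gc sep ck cl] := ct; have [[v _] _] := Gc.
have [x [y [vx vy nxy axy]]] := clique_tree_neighbour v ct L2.
have nb u : exists w, adj u w.
  by have [w [_ [uw _ _ _]]] := clique_tree_neighbour u ct L2; exists w.
split=> //.
- split.
    split; first by apply/card_ge2P; exists x, y.
    move=> S [|//] _; rewrite II0 card_eq0 => /eqP ->.
    suff -> : del (whole G) set0 = whole G by [].
    by rewrite wholeE del_inducedE setD0.
  (* Deleting [v] separates its nonadjacent neighbours [x] and [y], so connectivity 2 is
     excluded. *)
  move=> m [_ mc]; rewrite leqNgt; apply/negP => m1.
  have := (mc [set v] 1 m1 card_set1).2 x y.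
  case; [by split=> // e; apply: (adj_neq vx) | by split=> // e; apply: (adj_neq vy)|].
  move=> vx' xy; apply: axy; apply: (sep v) => //.
  exact/linked_del.
- move=> B bB; have [[u Bu] _] := bB.1.1.
  have [w uw ->] := block_edge_clique sep (nb u) bB Bu; split; first exact: ck.
  by move=> z z' Bz Bz' zz'; apply/inducedE; split=> //; apply: (edge_clique_clique sep uw).
- by move=> u; rewrite (card_eql (card_blocks_at sep (nb u))).
Qed.

End CliqueTree.

Lemma edge_clique_image (G : graph) (a b : G -> G) x y : inverse_automorphisms a b ->
  edge_clique (a x) (a y) = a @` edge_clique x y.
Proof.
move=> ab; rewrite -(preimage_imageE _ ab); have [aK bK aA bA] := ab.
have eqE u z : (z = a u) = (b z = u).
  by apply: propext; split=> [->|<-]; rewrite ?aK ?bK.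
have adjE u z : adj (a u) z = adj u (b z) by rewrite -bA aK.
by apply/seteqP; split=> z; rewrite /edge_clique /preimage /= !eqE !adjE.
Qed.

(** Nonadjacent neighbours of [v] can be moved to [x0], [y0], whose only common neighbour is the
    separating vertex [v0]; so [v] moves to [v0] and separates them as well. *)
Lemma two_distance_transitive_clique_tree (G : graph) : connected (whole G) ->
    k_distance_transitive 2 G ->
    (exists v x y : G, [/\ adj v x, adj v y & ~ reach (~` [set v]) x y]) ->
  exists K L : Type, [/\ `I_2 #<= [set: K], `I_2 #<= [set: L] & clique_tree K L G].
Proof.
move=> Gc dt [v0 [x0 [y0 [vx vy nr]]]].
have nv u : adj v0 u -> (~` [set v0]) u by move=> vu e; apply: (adj_neq vu).
have nxy : x0 <> y0 by move=> e; apply: nr; rewrite -e; apply/reach_refl/nv.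
have axy : ~ adj x0 y0 by move=> h; apply: nr; apply: reach_edge => //; apply: nv.
have sep : neighbours_separated G.
  move=> v x y avx avy xy; apply: contraPT => /negP naxy rxy.
  rewrite adjC in vx; rewrite adjC in avx.
  have [a [b [ab ax ay]]] :=
    distance2_transitive dt avx avy xy naxy vx vy nxy axy.
  have [aK bK aA bA] := ab.
  have av : a v = v0.
    apply: contrapT => av; apply: nr; apply: (@reach_trans _ _ (a v)).
      by apply: reach_edge; [apply: nv; rewrite adjC | | rewrite -ax aA].
    by apply: reach_edge; [| exact: nv | rewrite -ay aA].
  apply: nr; rewrite -ax -ay; apply: reach_image rxy => u; first by move=> w; rewrite aA.
  by move=> uv au; apply: uv; exact: (can_inj aK (etrans au (esym av))).
(* The two cardinals are read off at [v0]; transitivity on edges and on vertices makes them the same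
   everywhere. *)
exists (set_type (edge_clique v0 x0)), (set_type (cliques_at v0)); split.
- rewrite (card_le_eqr (card_setT _)); apply/card_ge2P; exists v0, x0; split.
  + exact: edge_clique_l.
  + exact: edge_clique_r.
  + exact: adj_neq.
- rewrite (card_le_eqr (card_setT _)); apply/card_ge2P.
  exists (edge_clique v0 x0), (edge_clique v0 y0); split; [by exists x0 | by exists y0|].
  move=> e; have : edge_clique v0 x0 y0 by rewrite e; apply: edge_clique_r.
  by case=> _ [yx|//]; apply: nxy.
split=> //.
- move=> x y xy; rewrite (card_eqr (card_setT _)).
  have [a [b [ab <- <-]]] := edge_transitive dt vx xy.
  rewrite (edge_clique_image _ _ ab); apply: inj_card_eq => u w _ _.
  by have [aK _ _ _] := ab; exact: (can_inj aK).
- move=> v; rewrite (card_eqr (card_setT _)).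
  have [a [ia av _]] := dt _ _ _ _ 0 isT (distance0 v0) (distance0 v).
  have [b ab] := isomorphism_inverse ia; have [aK bK aA bA] := ab.
  have -> : cliques_at v = (image^~ a) @` cliques_at v0.
    apply/seteqP; split=> A.
      move=> [y vy' <-]; exists (edge_clique v0 (b y)).
        by exists (b y) => //; rewrite /= -aA bK av.
      by rewrite -(edge_clique_image _ _ ab) bK av.
    move=> [_ [y vy' <-] <-]; rewrite -(edge_clique_image _ _ ab) av.
    by exists (a y) => //; rewrite /= -av aA.
  apply: inj_card_eq => A A' _ _; rewrite -!(preimage_imageE _ ab).
  exact: (preimage_inj ab).
Qed.

(** * Automorphisms of clique trees *)

(** [u0] is the default value outside [A], turning a bijection of subtypes into a total function. *)
Lemma card_eq_bij T U (A : set T) (B : set U) : U -> A #= B ->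
  exists f : T -> U, set_bij A B f.
Proof.
move=> u0 /card_bijP[f [g fg gf]].
pose h x := if pselect (A x) is left Ax then set_val (f (SigSub (mem_set Ax))) else u0.
have hE x (Ax : A x) : h x = set_val (f (SigSub (mem_set Ax))).
  by rewrite /h; case: pselect => // Ax'; rewrite (Prop_irrelevance Ax' Ax).
exists h; split.
- by move=> x Ax; rewrite hE; apply: set_valP.
- move=> x y /set_mem Ax /set_mem Ay; rewrite (hE x Ax) (hE y Ay) => /val_inj/(can_inj fg).
  by move=> /(congr1 set_val).
- move=> y By; have Ag := set_valP (g (SigSub (mem_set By))).
  exists (set_val (g (SigSub (mem_set By)))) => //; rewrite (hE _ Ag).
  have -> : SigSub (mem_set Ag) = g (SigSub (mem_set By)) by apply: val_inj.
  by rewrite gf.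
Qed.

(** Swap the values of [f] at [a] and at the preimage of [b]. Being explicit about what stays
    unchanged allows several redirections in a row. *)
Lemma set_bij_redirect T U (A : set T) (B : set U) (f : T -> U) a b :
    set_bij A B f -> A a -> B b ->
  exists g, [/\ set_bij A B g, g a = b &
    forall x, A x -> x <> a -> f x <> b -> g x = f x].
Proof.
move=> [fAB fi fs] Aa Bb; have [c Ac fc] := fs b Bb.
have inj x y : A x -> A y -> f x = f y -> x = y.
  by move=> Ax Ay; apply: fi; apply: mem_set.
pose g x := if pselect (x = a) is left _ then b
            else if pselect (x = c) is left _ then f a else f x.
have ga : g a = b by rewrite /g; case: pselect.
have gc : c <> a -> g c = f a.
  by move=> ca; rewrite /g; case: pselect => // _; case: pselect.
have gE x : x <> a -> x <> c -> g x = f x.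
  by move=> xa xc; rewrite /g; case: pselect => // _; case: pselect.
exists g; split=> //; last by move=> x Ax xa fxb; apply: gE => // xc; apply: fxb; rewrite xc.
split.
- move=> x Ax; have [->|xa] := pselect (x = a); first by rewrite ga.
  have [xc|xc] := pselect (x = c); first by rewrite xc gc -?xc //; apply: fAB.
  by rewrite gE //; apply: fAB.
- move=> x y /set_mem Ax /set_mem Ay.
  have [->|xa] := pselect (x = a); have [->|ya] := pselect (y = a) => //; rewrite ?ga.
  + have [yc|yc] := pselect (y = c).
      by rewrite yc gc -?yc // -fc => /inj e; rewrite -(e Ac Aa) -yc.
    by rewrite gE // -fc => /inj e; case: yc; rewrite e.
  + have [xc|xc] := pselect (x = c).
      by rewrite xc gc -?xc // -fc => /inj e; rewrite -xc in e; case: xa; rewrite e.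
    by rewrite gE // -fc => /inj e; case: xc; rewrite e.
  + have [xc|xc] := pselect (x = c); have [yc|yc] := pselect (y = c); first by rewrite xc yc.
    * rewrite xc gc -?xc // gE // => /inj e; case: ya; rewrite e //.
    * rewrite yc gc -?yc // gE // => /inj e; case: xa; rewrite e //.
    * by rewrite !gE //; apply: inj.
- move=> y By; have [x Ax fx] := fs y By.
  have [xa|xa] := pselect (x = a).
    have [ca|ca] := pselect (c = a); first by exists a => //; rewrite ga -fx xa -ca fc.
    by exists c => //; rewrite gc // -fx xa.
  have [xc|xc] := pselect (x = c); first by exists a => //; rewrite ga -fx xc fc.
  by exists x => //; rewrite gE.
Qed.

(** * Reduced walks and their uniqueness *)

Section ReducedWalks.
Variable G : graph.
Hypothesis Gconn : connected (whole G).
Hypothesis Gsep : neighbours_separated G.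
Implicit Types (x y z u v w : G) (p q : seq G).

Fixpoint reduced x p := match p with
  | [::] => True
  | z :: q => [/\ adj x z, if q is t :: _ then x <> t /\ ~ adj x t else True & reduced z q]
  end.

Lemma reduced_catl x p q : reduced x (p ++ q) -> reduced x p.
Proof.
elim: p x => //= z p IH x [xz xt /IH zp]; split=> //.
by case: p xt {IH zp}.
Qed.

Lemma not_reach_reduced2 x z t : reduced x [:: z; t] -> ~ reach (~` [set z]) x t.
Proof.
move=> [xz [nxt axt] [zt _ _]] xt; apply: axt; apply: Gsep xt => //.
by rewrite adjC.
Qed.

(** The walk beyond [t] never returns to [z], for a return would contradict the shorter case applied
    from [z]. So its end stays on the side of [t], which [z] separates from [x]. *)
Lemma reduced_first x z t p : reduced x (z :: t :: p) ->
  ~ reach (~` [set z]) x (last t p).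
Proof.
move: {2}(size p) (leqnn (size p)) => n; elim: n x z t p => [|n IH] x z t p.
  by case: p => // _; apply: not_reach_reduced2.
move=> pn xp xl.
suff tl : reach (~` [set z]) t (last t p).
  apply: (@not_reach_reduced2 x z t); first exact: (reduced_catl (q := p)).
  exact: reach_trans xl (reach_sym tl).
have {xl xp} [_ _ zp] := xp.
have zt : t <> z by move/esym; apply: adj_neq; case: zp.
elim/last_ind: p pn zp => [|p w IHp] pn zp; first exact: reach_refl.
rewrite last_rcons; rewrite size_rcons ltnS in pn.
have zp' : reduced z (t :: p) by move: zp; rewrite -cats1; apply: (@reduced_catl z (t :: p)).
apply: (@reach_step _ _ _ (last t p)); first by apply: IHp => //; apply: ltnW.
  move: zp => {IHp zp' pn zt}; elim: p z t => [|a p IHp] z t [_ _]; first by case.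
  exact: IHp.
move=> wz; case: p pn zp zp' {IHp} => [|a p] pn zp zp'.
  by case: zp => _ [zw _] _; apply: zw.
have := IH z t a (rcons p w); rewrite size_rcons last_rcons; apply=> //.
by rewrite wz; apply: reach_refl => /esym.
Qed.

Lemma reduced_avoid x z p : reduced x (z :: p) -> reach (~` [set x]) z (last z p).
Proof.
elim/last_ind: p => [|p w IHp] xp.
  by apply: reach_refl => /= /esym; apply: adj_neq; case: xp.
rewrite last_rcons; apply: (@reach_step _ _ _ (last z p)).
- by apply: IHp; move: xp; rewrite -cats1; apply: (@reduced_catl x (z :: p)).
- case: xp => _ _; elim: p z {IHp} => [|a p IHp] z; first by case.
  by case=> _ _; apply: IHp.
move=> wx; case: p xp {IHp} => [|a p] xp.
  by case: xp => _ [xw _] _; apply: xw.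
apply: (reduced_first xp); rewrite last_rcons wx; apply: reach_refl.
by apply: adj_neq; case: xp.
Qed.

(** [a] is on the same side of [b] as [x], hence separated from the vertex after [b]. *)
Lemma reduced_sibling x a b q : reduced x (b :: q) -> adj x a -> adj a b ->
  reduced a (b :: q).
Proof.
case: q => [|t q] xq xa ab; first by split.
have xbt : reduced x [:: b; t] by apply: (reduced_catl (q := q)).
have [xb _ bq] := xq; split=> //.
have xa' : reach (~` [set b]) x a.
  by apply: reach_edge => //; apply: adj_neq.
split=> [at_|at_]; apply: (not_reach_reduced2 xbt); first by rewrite -at_.
apply: (reach_step xa') at_ _ => /esym; apply: adj_neq.
by case: xbt => _ _ [].
Qed.

(** If the first vertices differ, both walks end at the same place avoiding [x], so these vertices
    are adjacent. A walk going on after its first vertex would be separated by it from [x], yet the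
    other walk bypasses that vertex; so both have length 1 and end differently. *)
Lemma reduced_unique x p q : reduced x p -> reduced x q -> last x p = last x q -> p = q.
Proof.
elim: p x q => [|a p IH] x [|b q] //.
- by move=> _ /reduced_avoid/reach_tgt /= xq e; case: xq.
- by move=> /reduced_avoid/reach_tgt /= xp _ e; case: xp.
move=> xp xq e; have [xa _ ap] := xp; have [xb _ bq] := xq.
have [ab|ab] := pselect (a = b).
  by rewrite -ab in bq e *; congr cons; apply: IH ap bq e.
have aab : adj a b.
  apply: Gsep (xa) (xb) ab _; apply: reach_trans (reduced_avoid xp) _.
  by rewrite /= in e; rewrite e; apply/reach_sym/reduced_avoid.
have short c d r r' : reduced x (c :: r) -> reduced x (d :: r') -> adj c d ->
    last c r = last d r' -> r = [::].
  case: r => // t r xr xr' cd e'; case: (reduced_first xr); rewrite /= in e'; rewrite e'.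
  have [xc _ _] := xr; have [xd _ _] := xr'.
  apply: reach_trans (reduced_avoid (reduced_sibling xr' xc cd)).
  by apply: reach_edge => //; [apply: adj_neq | move/esym; apply: adj_neq].
have p0 := short _ _ _ _ xp xq aab e.
have q0 : q = [::] by apply: short xq xp _ (esym e); rewrite adjC.
by move: e; rewrite p0 q0 /= => /ab.
Qed.

(** How the reduced walk to a fixed end changes when its start moves to a neighbour: it backtracks,
    slides within one clique, or grows. *)
Lemma reduced_neighbour z p y : reduced z p -> adj y z ->
  [\/ p = [::] /\ reduced y [:: z],
      exists q, p = y :: q /\ reduced y q,
      exists u q, [/\ p = u :: q, adj y u & reduced y p] |
      reduced y (z :: p)].
Proof.
case: p => [|u q] zp yz; first by apply: Or41.
have [yu|yu] := pselect (y = u).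
  by apply: Or42; exists q; rewrite yu; case: zp.
have [ayu|ayu] := pselect (adj y u : Prop).
  apply: Or43; exists u, q; split=> //; apply: (reduced_sibling zp) => //.
  by rewrite adjC.
by apply: Or44.
Qed.

Lemma path_reduced z s : path (@adj G) z s ->
  exists p, [/\ reduced z p, last z p = last z s & size p <= size s].
Proof.
elim: s z => [|y s IH] z /=; first by exists [::].
move=> /andP[zy /IH[p [yp lp sp]]].
case: (reduced_neighbour yp zy) => [[p0 zy']|[q [pq zq]]|[u [q [pq zu zp]]]|zp].
- by exists [:: y]; rewrite -lp p0; split.
- by exists q; rewrite -lp pq /=; split=> //; apply: leqW; apply: leq_trans sp; rewrite pq.
- by exists p; rewrite -lp; split=> //; [rewrite pq | apply: leqW].
- by exists (y :: p).
Qed.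

Lemma ex_reduced z x : exists p, reduced z p /\ last z p = x.
Proof.
have [_ [s [zs <-]]] := Gconn.2 z x I I.
by have [p [zp lp _]] := path_reduced zs; exists p.
Qed.

Lemma reduced_path x p : reduced x p -> path (@adj G) x p.
Proof. by elim: p x => //= z p IH x [-> _ /IH]. Qed.

Lemma distance_reduced x y n : distance x y n ->
  exists p, [/\ reduced x p, last x p = y & size p = n].
Proof.
move=> [[s [xs ls sn]] min]; have [p [xp lp sp]] := path_reduced xs.
exists p; split=> //; first by rewrite lp.
apply/eqP; rewrite eqn_leq -{1}sn sp min //; first exact: reduced_path.
by rewrite lp.
Qed.

End ReducedWalks.

(** * Isomorphisms between closed neighbourhoods *)

Section LocalIsomorphisms.
Variables (G : graph) (K L : Type).
Hypothesis Gct : clique_tree K L G.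
Hypothesis L2 : `I_2 #<= [set: L].
Implicit Types (x y z u v w p q : G) (s t f : G -> G).

Let Gconn : connected (whole G). Proof. by case: Gct. Qed.
Let Gsep : neighbours_separated G. Proof. by case: Gct. Qed.

Definition closed_nbhd z : set G := [set y | y = z \/ adj z y].

(** [s] is total, but only its values on the closed neighbourhood of [z] are constrained. *)
Definition local_isomorphism z s :=
  [/\ forall x y, closed_nbhd z x -> closed_nbhd z y -> s x = s y -> x = y,
      forall x y, closed_nbhd z x -> closed_nbhd z y -> adj (s x) (s y) = adj x y &
      forall w, closed_nbhd (s z) w -> exists2 y, closed_nbhd z y & s y = w].

Lemma local_isomorphism_adj z s y : local_isomorphism z s -> adj z y -> adj (s z) (s y).
Proof. by move=> [_ sA _] zy; rewrite sA //; [left|right]. Qed.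

Lemma edge_cliqueC x y : edge_clique x y = edge_clique y x.
Proof. by apply/seteqP; split=> z []. Qed.

Lemma edge_clique_adj z x y : adj z x -> edge_clique z x y -> y <> z -> adj z y.
Proof. by move=> zx [[->//|]]. Qed.

Lemma edge_clique_congr z x y : adj z x -> adj z y ->
  edge_clique z x = edge_clique z y <-> x = y \/ adj x y.
Proof.
move=> zx zy; split.
  move=> e; have : edge_clique z x y by rewrite e; apply: edge_clique_r.
  by case=> _ [->|]; [left|right].
case=> [->//|xy]; apply/esym/edge_clique_eq => //.
by split; right.
Qed.

(* Match the cliques at z with those at z', then glue one bijection per clique. *)
Lemma extend_clique_bijection z z' p p' t q q' : adj z p -> adj z' p' ->
    set_bij (edge_clique z p) (edge_clique z' p') t -> t z = z' ->
    adj z q -> ~ edge_clique z p q -> adj z' q' -> ~ edge_clique z' p' q' ->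
  exists s, [/\ local_isomorphism z s,
    forall y, edge_clique z p y -> s y = t y & s q = q'].
Proof.
move=> zp zp' tb tz zq npq zq' npq'; have [_ _ cK cL] := Gct.
set A := edge_clique z p in tb npq *; set A' := edge_clique z' p' in tb npq' *.
pose R := edge_clique z q; pose R' := edge_clique z' q'.
have AR : A <> R by move=> e; apply: npq; rewrite e; apply: edge_clique_r.
have AR' : A' <> R' by move=> e; apply: npq'; rewrite e; apply: edge_clique_r.
have cA : cliques_at z A by exists p.
have cA' : cliques_at z' A' by exists p'.
have cR : cliques_at z R by exists q.
have cR' : cliques_at z' R' by exists q'.
have [b [bb bA bR]] : exists b,
    [/\ set_bij (cliques_at z) (cliques_at z') b, b A = A' & b R = R'].
  have zz' : cliques_at z #= cliques_at z'.
    by apply: card_eq_trans (cL z) _; rewrite card_eq_sym.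
  have [b0 b0b] := card_eq_bij set0 zz'.
  have [b1 [b1b b1A _]] := set_bij_redirect b0b cA cA'.
  (* This changes only the values at [R] and at the preimage of [R'], so [A] still goes to [A']. *)
  have [b2 [b2b b2R b2E]] := set_bij_redirect b1b cR cR'.
  by exists b2; split=> //; rewrite b2E // b1A.
have [bf bi bs] := bb.
have binj P Q : cliques_at z P -> cliques_at z Q -> b P = b Q -> P = Q.
  by move=> hP hQ; apply: bi; apply: mem_set.
have clz x P : cliques_at x P -> P x by move=> [y xy <-]; apply: edge_clique_l.
have /choice[T hT] : forall P, exists h : G -> G, cliques_at z P ->
    [/\ set_bij P (b P) h, h z = z', P = A -> h = t & P = R -> h q = q'].
  move=> P.
  have [PA|PA] := pselect (P = A).
    exists t => cP; split=> //; first by rewrite PA bA.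
    by rewrite PA => /AR.
  have [cP|] := pselect (cliques_at z P); last by exists id.
  have PbP : P #= b P.
    have [y zy eP] := cP; have [y' zy' eP'] := bf _ cP.
    by rewrite -eP' -eP; apply: card_eq_trans (cK _ _ zy) _; rewrite card_eq_sym; apply: cK.
  have [h0 h0b] := card_eq_bij z' PbP.
  have [h1 [h1b h1z _]] := set_bij_redirect h0b (clz _ _ cP) (clz _ _ (bf _ cP)).
  have [PR|PR] := pselect (P = R); last by exists h1.
  have Pq : P q by rewrite PR; apply: edge_clique_r.
  have bPq : b P q' by rewrite PR bR; apply: edge_clique_r.
  have [h2 [h2b h2q h2E]] := set_bij_redirect h1b Pq bPq.
  exists h2; split=> //; rewrite h2E //; [exact: clz | exact: adj_neq|].
  by rewrite h1z; apply: adj_neq.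
(* Different maximal cliques at [z] share only [z], where all pieces take the value [z']; the gluing
   is therefore consistent. *)
pose s y := if pselect (y = z) is left _ then z' else T (edge_clique z y) y.
have sz : s z = z' by rewrite /s; case: pselect.
have sE y : adj z y -> s y = T (edge_clique z y) y.
  by rewrite /s => zy; case: pselect => // e; case: (adj_neq zy).
have sP P y : cliques_at z P -> P y -> s y = T P y.
  move=> cP Py; have [yz|yz] := pselect (y = z).
    by rewrite yz sz; have [_ ->] := hT P cP.
  have [u zu eP] := cP; have zy : adj z y by apply: edge_clique_adj zu _ yz; rewrite eP.
  rewrite sE //; congr (T _ _); rewrite -eP; apply: edge_clique_eq => //.
  by rewrite eP.
have cl y : adj z y -> cliques_at z (edge_clique z y) by move=> zy; exists y.
have tinj P : cliques_at z P -> forall x y, P x -> P y -> s x = s y -> x = y.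
  move=> cP x y Px Py; rewrite !(sP P) //; have [[_ ti _] _ _ _] := hT P cP.
  by apply: ti; apply: mem_set.
have sadj y : adj z y -> adj z' (s y) /\ edge_clique z' (s y) = b (edge_clique z y).
  move=> zy; have cy := cl y zy; have [[tf _ _] _ _ _] := hT _ cy.
  have bsy : b (edge_clique z y) (s y) by rewrite sE //; apply/tf/edge_clique_r.
  have nsy : s y <> z'.
    rewrite -sz => /(tinj _ cy y z (edge_clique_r zy) (edge_clique_l zy)).
    by move/esym; apply: adj_neq.
  have [u zu eP] := bf _ cy; rewrite -eP in bsy *.
  have zsy := edge_clique_adj zu bsy nsy.
  by split=> //; apply: edge_clique_eq.
(* Neighbours of [z] are equal or adjacent exactly when they span the same clique with [z], and [b]
   is injective on cliques. *)
have nbr x y : adj z x -> adj z y -> (s x = s y \/ adj (s x) (s y)) <-> (x = y \/ adj x y).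
  move=> zx zy; have [zsx ex] := sadj x zx; have [zsy ey] := sadj y zy.
  rewrite -(edge_clique_congr zx zy) -(edge_clique_congr zsx zsy) ex ey.
  by split=> [|->//]; apply: binj; apply: cl.
have inj x y : closed_nbhd z x -> closed_nbhd z y -> s x = s y -> x = y.
  move=> [->|zx] [->|zy] // e.
  - by have [zsy _] := sadj y zy; case: (adj_neq zsy); rewrite -e.
  - by have [zsx _] := sadj x zx; case: (adj_neq zsx); rewrite e.
  have exy : edge_clique z x = edge_clique z y.
    by apply/(edge_clique_congr zx zy)/(nbr x y zx zy); left.
  apply: (tinj _ (cl x zx)) => //; first exact: edge_clique_r.
  by rewrite exy; apply: edge_clique_r.
exists s; split.
- split=> //.
    move=> x y zx zy; have [->|nxy] := pselect (x = y); first by rewrite !adj_irr.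
    have nsxy : s x <> s y by move=> /(inj _ _ zx zy).
    case: zx zy nxy nsxy => [->|zx] [->|zy] nxy nsxy.
    + by case: nxy.
    + by rewrite sz zy; case: (sadj y zy).
    + by rewrite sz adjC [RHS]adjC zx; case: (sadj x zx).
    + apply/idP/idP => h.
        by case: ((nbr x y zx zy).1 (or_intror h)).
      by case: ((nbr x y zx zy).2 (or_intror h)).
  move=> w; rewrite sz => -[->|zw]; first by exists z; [left|].
  have [P cP bP] := bs _ (ex_intro2 _ _ w zw erefl).
  have [[_ _ ts] _ _ _] := hT P cP.
  have [y Py ty] : (T P @` P) w by apply: ts; rewrite bP; apply: edge_clique_r.
  exists y; last by rewrite (sP P).
  have [yz|yz] := pselect (y = z); [by left | right].
  by case: cP Py => u zu <- /(edge_clique_adj zu); apply.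
- by move=> y Ay; rewrite (sP A) //; have [_ _ ->] := hT A cA.
- by rewrite (sP R) //; [have [_ _ _ ->] := hT R cR | apply: edge_clique_r].
Qed.

Lemma leave_clique z p : adj z p -> exists2 q, adj z q & ~ edge_clique z p q.
Proof.
move=> zp; have [x [y [zx zy nxy axy]]] := clique_tree_neighbour z Gct L2.
have [Ax|nAx] := pselect (edge_clique z p x); last by exists x.
have [Ay|nAy] := pselect (edge_clique z p y); last by exists y.
by case: axy; apply: (edge_clique_clique Gsep zp).
Qed.

Lemma local_isomorphism_bij u z s : local_isomorphism u s -> adj u z ->
  set_bij (edge_clique z u) (edge_clique (s z) (s u)) s.
Proof.
move=> [si sA ss] uz; rewrite edge_cliqueC [edge_clique (s z) _]edge_cliqueC.
have Nz : closed_nbhd u z by right.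
have Nu : closed_nbhd u u by left.
split.
- move=> y [uy [->|zy]]; [split; [|by left] | split; [|by right; rewrite sA]].
    by right; rewrite sA.
  by case: uy (uy) => [->|uy] Ny; [left | right; rewrite sA].
- by move=> x y /set_mem[ux _] /set_mem[uy _]; apply: si.
- move=> w [/ss[y uy <-] zw]; exists y => //; split=> //.
  case: zw => [/(si _ _ uy Nz)->|]; first by left.
  by rewrite sA //; right.
Qed.

Lemma extend_local u z s q q' : local_isomorphism u s -> adj u z ->
    adj z q -> ~ edge_clique z u q -> adj (s z) q' -> ~ edge_clique (s z) (s u) q' ->
  exists s', [/\ local_isomorphism z s',
    forall y, edge_clique z u y -> s' y = s y & s' q = q'].
Proof.
move=> us uz zq nq zq' nq'; have uz' := local_isomorphism_adj us uz.
rewrite adjC in uz'; have sb := local_isomorphism_bij us uz; rewrite adjC in uz.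
exact: extend_clique_bijection uz uz' sb erefl zq nq zq' nq'.
Qed.

Lemma ex_local x y z w : adj x z -> adj y w ->
  exists s, [/\ local_isomorphism x s, s x = y & s z = w].
Proof.
move=> xz yw; have [_ _ cK _] := Gct.
have [q xq nq] := leave_clique xz; have [q' yq' nq'] := leave_clique yw.
have AB : edge_clique x z #= edge_clique y w.
  by apply: card_eq_trans (cK _ _ xz) _; rewrite card_eq_sym; apply: cK.
have [t0 t0b] := card_eq_bij y AB.
have [t1 [t1b t1x _]] := set_bij_redirect t0b (edge_clique_l xz) (edge_clique_l yw).
have [t2 [t2b t2z t2E]] := set_bij_redirect t1b (edge_clique_r xz) (edge_clique_r yw).
have t2x : t2 x = y.
  rewrite t2E //; [exact: edge_clique_l | exact: adj_neq |].
  by rewrite t1x; apply: adj_neq.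
have [s [xs st _]] := extend_clique_bijection xz yw t2b t2x xq nq yq' nq'.
by exists s; split=> //; rewrite st //; [exact: edge_clique_l | exact: edge_clique_r].
Qed.

(** One choice function for all steps keeps the values at different vertices compatible. Preferring
    [id] whenever [s] fixes the shared clique is what later makes automorphisms fix everything
    beyond it. *)
Lemma ex_extension : exists ext : G -> G -> (G -> G) -> G -> G,
  (forall u z s, local_isomorphism u s -> adj u z ->
    local_isomorphism z (ext u z s) /\ forall y, edge_clique z u y -> ext u z s y = s y) /\
  (forall u z s, (forall y, edge_clique z u y -> s y = y) -> ext u z s = id).
Proof.
have idP u : local_isomorphism u id by split=> // w; exists w.
have /choice[e he] : forall a : G * G * (G -> G), exists h : G -> G,
    (local_isomorphism a.1.1 a.2 -> adj a.1.1 a.1.2 -> local_isomorphism a.1.2 h /\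
       forall y, edge_clique a.1.2 a.1.1 y -> h y = a.2 y) /\
    ((forall y, edge_clique a.1.2 a.1.1 y -> a.2 y = y) -> h = id); last first.
  exists (fun u z s => e (u, z, s)).
  by split=> u z s; case: (he (u, z, s)).
move=> [[u z] s] /=.
have [sid|nid] := pselect (forall y, edge_clique z u y -> s y = y).
  exists id; split=> // _ _; split; first exact: idP.
  by move=> y /sid.
have [[us uz]|no] := pselect (local_isomorphism u s /\ adj u z); last first.
  by exists id; split=> [us uz|/nid//]; case: no.
have zu := uz; rewrite adjC in zu.
have [q zq nq] := leave_clique zu.
have zu' := local_isomorphism_adj us uz; rewrite adjC in zu'.
have [q' zq' nq'] := leave_clique zu'.
have [s' [zs' ss' _]] := extend_local us uz zq nq zq' nq'.
by exists s'; split=> // /nid.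
Qed.

End LocalIsomorphisms.

Lemma local_isomorphism_ext (G : graph) (z : G) (s f : G -> G) :
  (forall y, closed_nbhd z y -> f y = s y) -> local_isomorphism z s ->
  local_isomorphism z f.
Proof.
move=> fs [si sA ss]; split.
- by move=> x y zx zy; rewrite !fs //; apply: si.
- by move=> x y zx zy; rewrite !fs //; apply: sA.
- move=> w; rewrite fs; last by left.
  by move=> /ss[y zy <-]; exists y => //; apply: fs.
Qed.

(** * Developing a local isomorphism along reduced walks *)

Section Developing.
Variables (G : graph) (K L : Type).
Hypothesis Gct : clique_tree K L G.
Hypothesis L2 : `I_2 #<= [set: L].
Implicit Types (x y z u v w : G) (p q : seq G) (s f : G -> G).

Let Gconn : connected (whole G). Proof. by case: Gct. Qed.
Let Gsep : neighbours_separated G. Proof. by case: Gct. Qed.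

Lemma local_isomorphism_reduced f x p : (forall z, local_isomorphism z f) ->
  reduced x p -> reduced (f x) (map f p).
Proof.
move=> lf; elim: p x => //= z p IH x [xz xt zp].
split=> //; [exact: local_isomorphism_adj (lf x) xz | | exact: IH].
case: p xt zp {IH} => //= t p [xt axt] [zt _ _].
have [fi fA _] := lf z.
have Nx : closed_nbhd z x by right; rewrite adjC.
have Nt : closed_nbhd z t by right.
by rewrite fA //; split=> // /(fi _ _ Nx Nt).
Qed.

(** Reduced walks map to reduced walks, so their uniqueness gives injectivity and reflects
    adjacency; surjectivity spreads from one image vertex by connectedness. *)
Lemma local_isomorphism_global f : (forall z, local_isomorphism z f) -> isomorphism f.
Proof.
move=> lf.
have fi : injective f.
  move=> x y e; have [p [xp lp]] := ex_reduced Gconn Gsep x y.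
  have := reduced_unique Gsep (local_isomorphism_reduced lf xp) (I : reduced (f x) [::]).
  by rewrite last_map lp e => /(_ erefl); case: p lp {xp}.
have [[x0 _] Gc] := Gconn.
have fs y : exists x, f x = y.
  have := Gc (f x0) y I I; move: y; apply: linked_ind; first by exists x0.
  move=> y z _ [x <-] /= xz; have [_ _ fs] := lf x.
  by have [w _ <-] := fs z (or_intror xz); exists w.
split.
  have [g fg] := choice fs; exists g => // x; exact/fi.
move=> x y; apply/idP/idP; last exact: local_isomorphism_adj.
move=> fxy; have [p [xp lp]] := ex_reduced Gconn Gsep x y.
have xy' : reduced (f x) [:: f y] by [].
have := reduced_unique Gsep (local_isomorphism_reduced lf xp) xy'.
rewrite last_map lp => /(_ erefl); case: p xp lp => [|z [|]] //= [xz _ _] zy _.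
by rewrite -zy.
Qed.

Section Develop.
Variables (ext : G -> G -> (G -> G) -> G -> G) (x0 : G) (s0 : G -> G).
Hypothesis extP : forall u z s, local_isomorphism u s -> adj u z ->
  local_isomorphism z (ext u z s) /\ forall y, edge_clique z u y -> ext u z s y = s y.
Hypothesis ext_id : forall u z s,
  (forall y, edge_clique z u y -> s y = y) -> ext u z s = id.
Hypothesis s0P : local_isomorphism x0 s0.

(* The walk p leads from z back to x0. *)
Fixpoint transport z p := match p with
  | [::] => s0
  | u :: q => ext u z (transport u q)
  end.

Lemma transport_local z p : reduced z p -> last z p = x0 ->
  local_isomorphism z (transport z p).
Proof.
elim: p z => [|u p IH] z /=; first by move=> _ ->.
move=> [zu _ up] lp; rewrite adjC in zu.
by case: (extP (IH u up lp) zu).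
Qed.

Lemma transport_agree z u p y : reduced z (u :: p) -> last u p = x0 ->
  edge_clique z u y -> transport z (u :: p) y = transport u p y.
Proof.
move=> [zu _ up] lp zuy; rewrite adjC in zu.
by case: (extP (transport_local up lp) zu) => _; apply.
Qed.

Variable back : G -> seq G.
Hypothesis backP : forall z, reduced z (back z) /\ last z (back z) = x0.

Definition develop z := transport z (back z) z.

Lemma back_eq z p : reduced z p -> last z p = x0 -> back z = p.
Proof.
by move=> zp lp; have [zb lb] := backP z; apply: (reduced_unique Gsep zb zp); rewrite lp.
Qed.

(** Coherence of neighbouring values: either one walk to [x0] extends the other by a step, or both
    continue through a common [u], and then both transports agree with that of [u] on the clique
    containing [z], [y] and [u]. *)
Lemma develop_agree z y : closed_nbhd z y -> develop y = transport z (back z) y.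
Proof.
case=> [->//|zy]; have [zb lb] := backP z; have yz := zy; rewrite adjC in yz.
case: (reduced_neighbour Gsep zb yz) => [[b0 yz']|[q [bq yq]]|[u [q [bq yu yb]]]|yzb].
- have lz : last y [:: z] = x0 by rewrite -lb b0.
  rewrite /develop (back_eq yz' lz) b0 transport_agree //.
  exact: edge_clique_l.
- rewrite bq in zb lb *; rewrite transport_agree //; last exact: edge_clique_r.
  by rewrite /develop (back_eq yq lb).
- rewrite bq in zb lb yb *; rewrite /develop (back_eq yb lb) !transport_agree //.
    by split; [right | right; case: zb; rewrite [adj u y]adjC].
  exact: edge_clique_l.
- rewrite /develop (back_eq yzb lb) transport_agree //.
  exact: edge_clique_l.
Qed.

Lemma develop_isomorphism : isomorphism develop.
Proof.
apply: local_isomorphism_global => z; apply: local_isomorphism_ext (develop_agree (z := z)) _.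
by have [zb lb] := backP z; apply: transport_local.
Qed.

Lemma develop_base y : closed_nbhd x0 y -> develop y = s0 y.
Proof. by move=> /develop_agree; rewrite (back_eq (I : reduced x0 [::])). Qed.

(** Along a walk leading away from [x0], a transport that has become the identity remains so by
    [ext_id]. *)
Lemma develop_beyond u z p : reduced u (z :: p) -> back z = u :: back u ->
  transport z (back z) = id -> map develop p = p.
Proof.
elim: p u z => //= t p IH u z [uz [ut aut] zp] bz tz; have [zt _ _] := zp.
have tz' : adj t z by rewrite adjC.
have [zb lb] := backP z.
have bt : back t = z :: back z.
  apply: back_eq => //; rewrite bz in zb *; split=> //.
  by split; [move/esym | rewrite adjC].
have tt : transport t (back t) = id by rewrite bt /= tz; apply: ext_id.
by rewrite (IH z t) // {1}/develop tt.
Qed.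

Lemma develop_fix c p : reduced x0 (c :: p) ->
  (forall y, edge_clique c x0 y -> s0 y = y) -> map develop (c :: p) = c :: p.
Proof.
move=> xcp s0c; have [xc _ _] := xcp.
have b0 : back x0 = [::] by apply: back_eq.
have cx : adj c x0 by rewrite adjC.
have bc : back c = [:: x0] by apply: back_eq.
have tc : transport c (back c) = id by rewrite bc /=; apply: ext_id.
have fixp : map develop p = p by apply: (develop_beyond xcp) => //; rewrite bc b0.
by rewrite /= fixp /develop tc.
Qed.

End Develop.

Lemma extend_isomorphism x s : local_isomorphism x s -> exists f, [/\ isomorphism f,
  forall y, closed_nbhd x y -> f y = s y &
  forall c p, reduced x (c :: p) -> (forall y, edge_clique c x y -> s y = y) ->
    map f (c :: p) = c :: p].
Proof.
move=> xs; have [ext [extP ext_id]] := ex_extension Gct L2.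
have /choice[back backP] : forall z, exists p, reduced z p /\ last z p = x.
  by move=> z; apply: ex_reduced.
exists (develop ext s back); split.
- exact: (develop_isomorphism extP xs backP).
- exact: (develop_base extP xs backP).
- exact: (develop_fix ext_id backP).
Qed.

Lemma isomorphism_reduced f x p : isomorphism f -> reduced x p -> reduced (f x) (map f p).
Proof.
move=> [fb fA]; have fi := bij_inj fb.
elim: p x => //= z p IH x [xz xt /IH zp]; split=> //; first by rewrite fA.
by case: p xt {IH zp} => //= t p [xt axt]; rewrite fA; split=> // /fi.
Qed.

Lemma isomorphism_comp (f g : G -> G) :
  isomorphism f -> isomorphism g -> isomorphism (g \o f).
Proof.
move=> [fb fA] [gb gA]; split; first exact: bij_comp.
by move=> x y; rewrite /= gA fA.
Qed.

(** The tail is placed first. Then [a x] and [y] are both neighbours of [w] outside its clique with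
    [w'], so a local isomorphism at [w] fixing that clique takes one to the other, and its extension
    fixes the tail already placed. *)
Lemma walk_transitive x y p q : reduced x p -> reduced y q -> size p = size q ->
  exists f, [/\ isomorphism f, f x = y & map f p = q].
Proof.
have nb v : exists w, adj v w.
  by have [w [_ [vw _ _ _]]] := clique_tree_neighbour v Gct L2; exists w.
elim: p x y q => [|z p IH] x y [|w q] //=.
  move=> _ _ _; have [z xz] := nb x; have [w yw] := nb y.
  have [s [xs sx _]] := ex_local Gct L2 xz yw.
  have [f [fi fs _]] := extend_isomorphism xs.
  by exists f; split=> //; rewrite fs //; left.
move=> xzp ywq [pq]; have [xz _ zp] := xzp; have [yw _ wq] := ywq.
case: p q pq xzp ywq zp wq IH => [|z' p] [|w' q] //= pq xzp ywq zp wq IH.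
  rewrite adjC in xz; rewrite adjC in yw.
  have [s [zs sz sx]] := ex_local Gct L2 xz yw.
  have [f [fi fs _]] := extend_isomorphism zs.
  by exists f; split=> //; [rewrite fs //; right | rewrite fs ?sz //; left].
have [a [ia az azp]] := IH z w (w' :: q) zp wq pq.
have := isomorphism_reduced (p := z :: z' :: p) ia xzp.
rewrite [map a _]/= az [a z' :: map a p]azp => axp.
have [ww' _ _] := wq; have w'w : adj w' w by rewrite adjC.
have idP u : local_isomorphism u id by split=> // v; exists v.
have out u : reduced u (w :: w' :: q) -> adj w u /\ ~ edge_clique w w' u.
  move=> [uw [uw' auw'] _]; rewrite adjC in uw; split=> // -[_ [e|h]]; first exact: uw'.
  by apply: auw'; rewrite adjC.
have [wax nax] := out _ axp; have [wy ny] := out _ ywq.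
have [s [ws sid sx]] := extend_local Gct (idP w') w'w wax nax wy ny.
have [f [fi fs fid]] := extend_isomorphism ws.
exists (f \o a); split; first exact: isomorphism_comp.
  by rewrite /= fs //; right.
rewrite -[LHS]/(map (f \o a) (z :: z' :: p)) map_comp.
have -> : map a (z :: z' :: p) = w :: w' :: q by rewrite /= az azp.
rewrite map_cons fs; last by left.
rewrite sid; last exact: edge_clique_l.
congr cons; apply: fid => // u; rewrite edge_cliqueC; exact: sid.
Qed.

Lemma clique_tree_distance_transitive : distance_transitive G.
Proof.
move=> k x1 x2 y1 y2 n _ /(distance_reduced Gsep)[p [xp <- pn]].
move=> /(distance_reduced Gsep)[q [yq <- qn]].
have [f [fi fx fp]] := walk_transitive xp yq (etrans pn (esym qn)).
by exists f; split=> //; rewrite -(last_map f) fx fp.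
Qed.

End Developing.

(** * Transfer along isomorphisms and the equivalence *)

Lemma isomorphic_distance_transitive (G H : graph) :
  isomorphic G H -> distance_transitive H -> distance_transitive G.
Proof.
move=> [f fi]; have [g [gi fg gf]] := isomorphism_inv fi.
have map_path (A B : graph) (h : A -> B) x p : isomorphism h ->
    path (@adj A) x p -> path (@adj B) (h x) (map h p).
  by move=> [_ hA]; elim: p x => //= y p IH x /andP[xy /IH ->]; rewrite hA xy.
have dist x y n : distance x y n -> distance (f x) (f y) n.
  move=> [[p [xp lp pn]] min]; split.
    by exists (map f p); rewrite last_map lp size_map; split=> //; apply: map_path.
  move=> q xq lq; rewrite -(size_map g); apply: min.
    by rewrite -[x]fg; apply: map_path.
  by rewrite -[x]fg last_map lq fg.
move=> Hdt k x1 x2 y1 y2 n nk dx dy.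
have [a [[ab aA] ax ay]] := Hdt k _ _ _ _ n nk (dist _ _ _ dx) (dist _ _ _ dy).
exists (g \o (a \o f)); split.
- have [fb fA] := fi; have [gb gA] := gi; split; first by do 2!apply: bij_comp => //.
  by move=> x y; rewrite /= gA aA fA.
- by rewrite /= ax fg.
- by rewrite /= ay fg.
Qed.

Theorem theorem1p1 (G : graph)
    (Gconn : connected (whole G))
    (Ginf : infinite_set [set: G])
    (Gends : exists e f : set (nat -> G), [/\ ends G e, ends G f & e <> f]) :
  (distance_transitive G <-> k_distance_transitive 2 G) /\
  (k_distance_transitive 2 G <->
   exists K L : Type,
     [/\ `I_2 #<= [set: K], `I_2 #<= [set: L] &
         exists X : graph, is_X K L X /\ isomorphic G X]).
Proof.
have to_X : k_distance_transitive 2 G -> exists K L : Type,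
    [/\ `I_2 #<= [set: K], `I_2 #<= [set: L] &
        exists X : graph, is_X K L X /\ isomorphic G X].
  move=> dt; have [e [f [he hf ef]]] := Gends.
  have [r [s [S [rr rs fS rS]]]] := ends_separated he hf ef.
  have cut := ex_local_cutvertex Gconn dt (ex_intro2 _ _ S fS (separates_end_cut rr rs rS)).
  have [K [L [K2 L2 ct]]] := two_distance_transitive_clique_tree Gconn dt cut.
  exists K, L; split=> //; exists G; split; first exact: clique_tree_is_X ct L2.
  by exists id; split=> //; exists id.
have of_X : (exists K L : Type, [/\ `I_2 #<= [set: K], `I_2 #<= [set: L] &
    exists X : graph, is_X K L X /\ isomorphic G X]) -> distance_transitive G.
  move=> [K [L [_ L2 [X [/is_X_clique_tree ct GX]]]]].
  exact: isomorphic_distance_transitive GX (clique_tree_distance_transitive ct L2).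
split; split; [by apply | by move/to_X/of_X | exact: to_X | by move/of_X; apply].
Qed.
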